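(* Let $I\times_f F$ be an $n$-dimensional generalized Robertson-Walker space and $L$ a totally umbilic null hypersurface. For each $(t_0,x_0)\in L$ one can construct another totally umbilic null hypersurface $\widetilde L_{(t_0,x_0)}$ (called the dual of $L$ through $(t_0,x_0)$). Specifically, if $L$ induces a twisted decomposition $\big(J\times S, ds^2+\mu(s,z)^2g_S\big)$ of $F$ in a neighborhood of $x_0$ in which $L$ is $$\Big\{(t,s,z)\in I\times J\times S:\ s=\int_{t_0}^t\frac{1}{f(r)}\,dr\Big\},$$ then $\widetilde L_{(t_0,x_0)}$ is given by $$\Big\{(t,s,z)\in I\times J\times S:\ s=\int_t^{t_0}\frac{1}{f(r)}\,dr\Big\}$$ and its null mean curvature is $$\widetilde H=\frac{n-2}{f(t)^2}\left(f'(t)-\frac{\mu_s(s,z)}{\mu(s,z)}\right),\qquad \mu_s=\frac{\partial\mu}{\partial s}.$$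
   Context: Generalized Robertson-Walker (GRW) space: $I\subset\mathbb{R}$ is an open interval, $f\in C^\infty(I)$ is positive, $(F,g_F)$ is a Riemannian manifold, and $I\times_f F$ denotes $I\times F$ with the Lorentzian metric $g=-dt^2+f(t)^2g_F$; $n$ denotes its dimension. Put $\zeta=f\partial_t$. A twisted product with one dimensional base is a product $J\times S$, with $J\subset\mathbb{R}$ an open interval and $(S,g_S)$ a Riemannian manifold, with metric $ds^2+\mu(s,z)^2g_S$ where $\mu\in C^\infty(J\times S)$ is positive. Here $0\in J$ and $x_0$ is identified with $(0,z_0)$ for some $z_0\in S$. For every totally umbilic null hypersurface $L$ of a GRW space and every $(t_0,x_0)\in L$ such a decomposition of $F$ near $x_0$, in which $L$ has locally the form displayed in the claim, exists; it is called the decomposition induced by $L$. A null hypersurface $L$ is a hypersurface on which the induced metric is degenerate. On $L$ take the unique null vector field $\xi\in\mathfrak{X}(L)$ with $g(\zeta,\xi)=1$, and $\mathcal{S}=\zeta^\perp\cap TL$. The null second fundamental form is $B(X,Y)=-g(\nabla_X\xi,Y)$ for $X,Y\in\mathcal{S}$. $L$ is totally umbilic if $B=\rho g$ for some $\rho\in C^\infty(L)$. The null mean curvature is $H_p=\sum_{i=3}^n B(e_i,e_i)$ for an orthonormal basis $\{e_3,\dots,e_n\}$ of $\mathcal{S}_p$. *)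

(* Defs.v *)
From HB Require Import structures.
From mathcomp Require Import all_boot all_order all_algebra.
From mathcomp Require Import all_classical all_reals all_analysis.
Import Order.TTheory GRing.Theory Num.Theory numFieldNormedType.Exports.

Set Implicit Arguments.
Unset Strict Implicit.
Unset Printing Implicit Defensive.

Local Open Scope classical_set_scope.
Local Open Scope ring_scope.

(* The installed libraries have no smooth manifolds.  Tensor calculus is first
   set up on coordinate domains of R^n; manifolds are given by atlases, and a
   geometric notion holds on a manifold when it holds in every chart of the
   atlas. *)

Section Smooth.
Variables (R : realType) (V : normedModType R).

Fixpoint Ck (k : nat) (U : set V) (f : V -> R) : Prop :=
  match k with
  | 0 => forall x, U x -> {for x, continuous f}
  | k'.+1 => (forall x, U x -> differentiable f x) /\
             (forall v, Ck k' U (fun x => 'D_v f x))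
  end.

(* only used on open sets [U] *)
Definition smooth_on (U : set V) (f : V -> R) : Prop := forall k, Ck k U f.

Definition smooth_map n (U : set V) (f : V -> 'rV[R]_n) : Prop :=
  forall j, smooth_on U (fun x => f x ord0 j).

End Smooth.

Section Coordinates.
Variables (R : realType) (n : nat).
Implicit Types (G : 'rV[R]_n -> 'M[R]_n) (x v w X Y : 'rV[R]_n).

Definition ip (A : 'M[R]_n) v w : R := (v *m A *m w^T) ord0 ord0.

(* row vector of the Christoffel symbols of the first kind,
   (1/2) (X(g(Y,d_l)) + Y(g(X,d_l)) - d_l(g(X,Y))) for constant X, Y *)
Definition christoffel1 G x X Y : 'rV[R]_n :=
  \row_l (2^-1 * ('D_X (fun y => ip (G y) Y (delta_mx ord0 l)) x
                + 'D_Y (fun y => ip (G y) X (delta_mx ord0 l)) x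
                - 'D_(delta_mx ord0 l) (fun y => ip (G y) X Y) x)).

(* Levi-Civita derivative at [x] of the vector field [V] in direction [X] *)
Definition nabla G (V : 'rV[R]_n -> 'rV[R]_n) x X : 'rV[R]_n :=
  'D_X V x + christoffel1 G x X (V x) *m invmx (G x).

Definition hypersurface (L : set 'rV[R]_n) : Prop :=
  forall x, L x -> exists (W : set 'rV[R]_n) (h : 'rV[R]_n -> R),
    [/\ open W, W x, smooth_on W h,
        (forall y, W y -> (L y <-> h y = 0)) &
        (forall y, W y -> exists v, 'D_v h y != 0)].

(* velocities at [x] of the smooth curves lying in [L] *)
Definition tangent (L : set 'rV[R]_n) x v : Prop :=
  exists (A : set R) (c : R -> 'rV[R]_n),
    [/\ open A, A 0, smooth_map A c, (forall t, A t -> L (c t)) &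
        c 0 = x /\ 'D_1 c 0 = v].

Definition null_hypersurface_in G (L : set 'rV[R]_n) : Prop :=
  hypersurface L /\
  forall x, L x -> exists2 v, tangent L x v /\ v != 0 &
    forall w, tangent L x w -> ip (G x) v w = 0.

(* The null vector field xi of L with g(zeta, xi) = 1.  A smooth field along L
   is represented by a smooth extension to a neighbourhood of L; for X tangent
   to L, [nabla G xi x X] depends only on the restriction of xi to L. *)
Definition null_section G (zeta : 'rV[R]_n -> 'rV[R]_n) (L : set 'rV[R]_n)
    (xi : 'rV[R]_n -> 'rV[R]_n) : Prop :=
  (exists W, [/\ open W, L `<=` W & smooth_map W xi]) /\
  forall x, L x -> [/\ tangent L x (xi x), ip (G x) (xi x) (xi x) = 0 &
                       ip (G x) (zeta x) (xi x) = 1].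

Definition screen G (zeta : 'rV[R]_n -> 'rV[R]_n) (L : set 'rV[R]_n) x X :=
  tangent L x X /\ ip (G x) (zeta x) X = 0.

Definition null_fundamental_form G (xi : 'rV[R]_n -> 'rV[R]_n) x X Y : R :=
  - ip (G x) (nabla G xi x X) Y.

Definition umbilic_in G zeta (L : set 'rV[R]_n) (rho : 'rV[R]_n -> R) : Prop :=
  (exists W, [/\ open W, L `<=` W & smooth_on W rho]) /\
  exists2 xi, null_section G zeta L xi &
    forall x X Y, L x -> screen G zeta L x X -> screen G zeta L x Y ->
      null_fundamental_form G xi x X Y = rho x * ip (G x) X Y.

Definition screen_onb G zeta L x k (e : 'I_k -> 'rV[R]_n) : Prop :=
  [/\ (forall i, screen G zeta L x (e i)),
      (forall i j, ip (G x) (e i) (e j) = (i == j)%:R) &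
      (forall X, screen G zeta L x X ->
         exists a : 'I_k -> R, X = \sum_i a i *: e i)].

(* [h] is the null mean curvature of [L] at [x] *)
Definition null_mean_curvature_in G zeta (L : set 'rV[R]_n) x (h : R) : Prop :=
  exists xi k (e : 'I_k -> 'rV[R]_n),
    [/\ null_section G zeta L xi, screen_onb G zeta L x e &
        h = \sum_i null_fundamental_form G xi x (e i) (e i)].

End Coordinates.

(* [cmap] matters on [cdom] only, and [cinv] on [cod] only *)
Record chart (R : realType) (M : topologicalType) (m : nat) := Chart {
  cdom : set M;
  cmap : M -> 'rV[R]_m;
  cinv : 'rV[R]_m -> M }.

Definition cod (R : realType) (M : topologicalType) m (c : chart R M m) :
  set 'rV[R]_m := cmap c @` cdom c.

Definition is_chart (R : realType) (M : topologicalType) m (c : chart R M m) :=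
  [/\ open (cdom c), open (cod c),
      (forall p, cdom c p -> cinv c (cmap c p) = p),
      (forall p, cdom c p -> {for p, continuous (cmap c)}) &
      (forall u, cod c u -> {for u, continuous (cinv c)})].

Definition overlap (R : realType) (M : topologicalType) m (c d : chart R M m) :
  set 'rV[R]_m := [set u | cod c u /\ cdom d (cinv c u)].

Definition transition (R : realType) (M : topologicalType) m
  (c d : chart R M m) (u : 'rV[R]_m) : 'rV[R]_m := cmap d (cinv c u).

Record manifold (R : realType) (m : nat) := Manifold {
  points :> topologicalType;
  atlas : set (chart R points m);
  manifold_hausdorff : hausdorff_space points;
  manifold_countable : @second_countable points;
  atlas_chart : forall c, atlas c -> is_chart c;
  atlas_cover : forall p : points, exists2 c, atlas c & cdom c p;
  atlas_smooth : forall c d, atlas c -> atlas d ->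
    smooth_map (overlap c d) (transition c d) }.

(* [gram c u] is the Gram matrix of the coordinate frame of [c] at the point
   of coordinates [u] *)
Record riemannian (R : realType) (m : nat) := Riemannian {
  base :> manifold R m;
  gram : chart R base m -> 'rV[R]_m -> 'M[R]_m;
  gram_smooth : forall c, atlas c ->
    forall i j, smooth_on (cod c) (fun u => gram c u i j);
  gram_sym : forall c u, atlas c -> cod c u -> (gram c u)^T = gram c u;
  gram_pos : forall c u v, atlas c -> cod c u -> v != 0 ->
    0 < ip (gram c u) v v;
  gram_compat : forall c d u v w, atlas c -> atlas d -> overlap c d u ->
    ip (gram c u) v w =
    ip (gram d (transition c d u))
       ('d (transition c d) u v) ('d (transition c d) u w) }.

(* dim F = 1 + m, so that dim (I x_f F) = n = 2 + m and n - 2 = m *)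

Definition open_interval (R : realType) (I : set R) : Prop :=
  [/\ open I, is_interval I & I !=set0].

Definition hd (R : realType) k (u : 'rV[R]_(1 + k)) : R := lsubmx u ord0 ord0.
Definition tl (R : realType) k (u : 'rV[R]_(1 + k)) : 'rV[R]_k := rsubmx u.
Definition cons_rv (R : realType) k (a : R) (u : 'rV[R]_k) : 'rV[R]_(1 + k) :=
  row_mx a%:M u.

Section GRW.
Variables (R : realType) (m : nat) (I : set R) (f : R -> R).
Variable F : riemannian R (1 + m).

(* The charts of I x F are the products of the identity of I with the charts
   of F; a chart [c] of F stands for this product. *)

Definition grw_metric (c : chart R F (1 + m)) (u : 'rV[R]_(1 + (1 + m))) :
    'M[R]_(1 + (1 + m)) :=
  block_mx (-1)%:M 0 0 (f (hd u) ^+ 2 *: gram c (tl u)).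

(* zeta = f d_t *)
Definition grw_zeta (u : 'rV[R]_(1 + (1 + m))) : 'rV[R]_(1 + (1 + m)) :=
  cons_rv (f (hd u)) 0.

Definition grw_point (c : chart R F (1 + m)) (u : 'rV[R]_(1 + (1 + m))) :
  R * F := (hd u, cinv c (tl u)).

Definition in_chart (c : chart R F (1 + m)) (L : set (R * F)) :
    set 'rV[R]_(1 + (1 + m)) :=
  [set u | [/\ I (hd u), cod c (tl u) & L (grw_point c u)]].

Definition null_hypersurface (L : set (R * F)) : Prop :=
  (forall q, L q -> I q.1) /\
  forall c, atlas c -> null_hypersurface_in (grw_metric c) (in_chart c L).

(* off [L], the values of [rho] only serve as a smooth extension *)
Definition totally_umbilic (L : set (R * F)) : Prop :=
  exists rho : R * F -> R, forall c, atlas c ->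
    umbilic_in (grw_metric c) grw_zeta (in_chart c L)
      (fun u => rho (grw_point c u)).

Definition totally_umbilic_null (L : set (R * F)) : Prop :=
  null_hypersurface L /\ totally_umbilic L.

Definition null_mean_curvature (L : set (R * F)) (q : R * F) (h : R) : Prop :=
  forall c, atlas c -> cdom c q.2 ->
    null_mean_curvature_in (grw_metric c) grw_zeta (in_chart c L)
      (cons_rv q.1 (cmap c q.2)) h.

End GRW.

(* The decomposition of F near [x0]: [Psi] is an isometry from
   (J x S, ds^2 + mu^2 g_S) onto an open neighbourhood of [x0] in F, with
   inverse [Theta] and Psi (0, z0) = x0. *)
Record twisted_decomposition (R : realType) (m : nat) (F : riemannian R (1 + m))
    (x0 : F) := TwistedDecomposition {
  tdJ : set R;
  tdS : riemannian R m;
  tdmu : R -> tdS -> R;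
  tdPsi : R * tdS -> F;
  tdTheta : F -> R * tdS;
  tdz0 : tdS;
  tdV : set F := [set tdPsi p | p in [set p | tdJ p.1]];
  tdJ_interval : open_interval tdJ;
  tdJ0 : tdJ 0;
  td_origin : tdPsi (0, tdz0) = x0;
  tdmu_gt0 : forall s z, tdJ s -> 0 < tdmu s z;
  tdmu_smooth : forall d, atlas d ->
    smooth_on [set u : 'rV[R]_(1 + m) | tdJ (hd u) /\ cod d (tl u)]
      (fun u => tdmu (hd u) (cinv d (tl u)));
  tdV_open : open tdV;
  tdPsiK : forall p, tdJ p.1 -> tdTheta (tdPsi p) = p;
  tdPsi_cont : forall p, tdJ p.1 -> {for p, continuous tdPsi};
  tdTheta_cont : forall x, tdV x -> {for x, continuous tdTheta};
  tdPsi_dom (d : chart R tdS m) (c : chart R F (1 + m)) :=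
    [set u : 'rV[R]_(1 + m) | [/\ tdJ (hd u), cod d (tl u) &
                                cdom c (tdPsi (hd u, cinv d (tl u)))]];
  tdPsi_loc (d : chart R tdS m) (c : chart R F (1 + m)) (u : 'rV[R]_(1 + m)) :=
    cmap c (tdPsi (hd u, cinv d (tl u)));
  tdPsi_smooth : forall d c, atlas d -> atlas c ->
    smooth_map (tdPsi_dom d c) (tdPsi_loc d c);
  tdTheta_smooth : forall d c, atlas d -> atlas c ->
    smooth_map
      [set v : 'rV[R]_(1 + m) | [/\ cod c v, tdV (cinv c v) &
                                  cdom d (tdTheta (cinv c v)).2]]
      (fun v => let p := tdTheta (cinv c v) in cons_rv p.1 (cmap d p.2));
  td_isometry : forall d c u v w, atlas d -> atlas c -> tdPsi_dom d c u ->
    ip (gram c (tdPsi_loc d c u))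
       ('d (tdPsi_loc d c) u v) ('d (tdPsi_loc d c) u w) =
    hd v * hd w
    + tdmu (hd u) (cinv d (tl u)) ^+ 2 * ip (gram d (tl u)) (tl v) (tl w) }.

Arguments tdmu {R m F x0} t _ _.
Arguments tdPsi {R m F x0} t _.
Arguments tdTheta {R m F x0} t _.

(* integral of [h] from [a] to [b], in either order *)
Definition oriented_integral (R : realType) (h : R -> R) (a b : R) : R :=
  if a <= b then \int[lebesgue_measure]_(r in `[a, b]) h r
  else - \int[lebesgue_measure]_(r in `[b, a]) h r.

Section Dual.
Variables (R : realType) (m : nat) (I : set R) (f : R -> R).
Variables (F : riemannian R (1 + m)) (t0 : R) (x0 : F).
Implicit Types (D : twisted_decomposition x0) (L : set (R * F)).

Definition primal_set D : set (R * F) :=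
  [set q | exists t s z, [/\ I t, tdJ D s,
     s = oriented_integral (fun r => (f r)^-1) t0 t & q = (t, tdPsi D (s, z))]].

Definition dual_set D : set (R * F) :=
  [set q | exists t s z, [/\ I t, tdJ D s,
     s = oriented_integral (fun r => (f r)^-1) t t0 & q = (t, tdPsi D (s, z))]].

(* [L] has locally, around (t0, x0), the form [primal_set D] *)
Definition induced_by L D : Prop :=
  \forall q \near ((t0, x0) : R * F), L q <-> primal_set D q.

Definition is_dual L Lt : Prop :=
  exists2 D : twisted_decomposition x0, induced_by L D & Lt = dual_set D.

End Dual.

(* Main.v *)
Require Import Defs.
From HB Require Import structures.
From mathcomp Require Import all_boot all_order all_algebra ring.
From mathcomp Require Import all_classical all_reals all_analysis.
Import Order.TTheory GRing.Theory Num.Theory numFieldNormedType.Exports.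

Local Open Scope classical_set_scope.
Local Open Scope ring_scope.

(** The dual hypersurface is the zero set of the function [height],
    h = s + P(t), where s is the first coordinate of the twisted decomposition
    and P, called [conformal_time], is the primitive of 1/f that vanishes at
    t0: indeed s is the integral of 1/f from t to t0 exactly when h = 0.

    In the product coordinates (t, s, z) the metric is
    - dt^2 + f^2 (ds^2 + mu^2 g_S), and the gradient of h is
    xi = - f^-1 d_t + f^-2 d_s.  It is null, so the level set {h = 0} is a null
    hypersurface, and since g(zeta, xi) = 1 it is the null field that enters the
    definitions of total umbilicity and of null mean curvature.  Vectors tangent
    to {h = 0} and orthogonal to zeta are the vectors tangent to S.

    As xi is a gradient, its covariant derivative is the Hessian of h, a
    symmetric form; hence g(nabla_X xi, Y) = (1/2) (L_xi g)(X, Y)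
    ([nabla_gradient]).  The Lie derivative does not depend on coordinates, so it
    can be computed in the product coordinates, where xi has components that do
    not vary along S: on vectors tangent to S it just differentiates
    f^2 mu^2 g_S in the direction xi ([lie_derivative_pullback] and
    [dual_fundamental_form]).  This gives B = rho g with
    rho = (f' - mu_s / mu) / f^2, and the null mean curvature is the trace
    (n - 2) rho.

    All notions are stated in the charts of I x F, whereas the product
    coordinates come from a chart d of S.  The map [straight] from the latter
    coordinates to a chart of I x F, an isometry by the definition of a twisted
    decomposition, links the two.  It also yields explicit curves in the dual
    through a point in each tangent direction ([dual_curve]), so that tangent
    spaces are found without an implicit function theorem.

    The dual differs from the given hypersurface because for t > t0 close to t0
    the latter contains a point with s = P(t) > 0, while the dual requires
    s = - P(t). *)

Set Implicit Arguments.
Unset Strict Implicit.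

(** * Functions that agree near a point or along a line *)

Lemma near_open (T : topologicalType) (U : set T) x :
  open U -> U x -> \forall y \near x, U y.
Proof. by move=> oU Ux; apply: open_nbhs_nbhs. Qed.

Section NearEqual.
Variables (R : realType) (V W : normedModType R).
Implicit Types (f g : V -> W) (x v : V).

(** The zero function is an affine approximation of [f] at [x] with error
    identically 0 near [x]; this is what makes differentiability a local
    notion. *)
Lemma near0_differentiable f x : (\near x, f x = 0) -> differentiable f x.
Proof.
move=> f0; apply/diff_locallyP.
have E : f \o shift x = cst (f x) + (0 : V -> W) +o_ 0 id.
  rewrite (nbhs_singleton f0) addr0; apply/eqaddoP => _ /posnumP[e].
  have : \forall h \near (0 : V), f (h + x) = 0.
    have c : (h + x) @[h --> (0:V)] --> x.
      by rewrite -[X in _ --> X]add0r; apply: cvgD; [exact: cvg_id|exact: cvg_cst].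
    exact: (c _ f0).
  apply: filterS => h /= hE.
  by rewrite !fctE /= hE subrr normr0 mulr_ge0.
have c0 : continuous (0 : V -> W) by move=> y; exact: cvg_cst.
pose z : {linear V -> W} := \0.
by rewrite (@diff_unique _ _ _ f z).
Qed.

Lemma near_eq_differentiable f g x :
  (\near x, f x = g x) -> differentiable f x -> differentiable g x.
Proof.
move=> fg df; rewrite -[g](subrK f).
apply: differentiableD; last exact: df.
apply: near0_differentiable.
by apply: filterS fg => y /= yE; rewrite !fctE yE subrr.
Qed.

Lemma derive_along f x v : 'D_v f x = 'D_1 (fun h : R => f (h *: v + x)) 0.
Proof.
rewrite /derive; set g1 := fun h => h^-1 *: _; set g2 := fun h => h^-1 *: _.
suff -> : g1 = g2 by [].
by rewrite funeqE /g1 /g2 => h /=; rewrite addr0 scale0r add0r [_%:A]mulr1.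
Qed.

Lemma near_line x v (P : set V) : (\forall y \near x, P y) ->
  \forall h \near (0 : R), P (h *: v + x).
Proof.
move=> nP; have c : (h *: v + x) @[h --> (0 : R)] --> x.
  rewrite -[X in _ --> X]add0r; apply: cvgD; last exact: cvg_cst.
  by rewrite -[X in _ --> X](scale0r v); apply: cvgZr_tmp; exact: cvg_id.
exact: (c P nP).
Qed.

Lemma near_line_derive f g x v :
  (\forall h \near (0 : R), f (h *: v + x) = g (h *: v + x)) ->
  'D_v f x = 'D_v g x.
Proof. by move=> fg; rewrite !derive_along; exact: near_eq_derive. Qed.

Lemma is_derive_const_along f x v :
  (forall h : R, f (h *: v + x) = f x) -> is_derive x v f 0.
Proof.
move=> fx.
have E : (fun h : R => f (h *: v + x)) = cst (f x) by apply/funext.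
have dv : derivable f x v.
  by apply/derivable1P; rewrite E; exact: derivable_cst.
split=> //; apply: (eq_trans (derive_along _ _ _)); rewrite E.
exact: derive_cst.
Qed.

End NearEqual.

Section Directional.
Variables (R : realType) (V V' W : normedModType R).

Lemma deriveZdir (f : V -> W) x (a : R) (v : V) : differentiable f x ->
  'D_(a *: v) f x = a *: 'D_v f x.
Proof. by move=> df; rewrite !deriveE// linearZ. Qed.

Lemma derive_sumdir (I : Type) (r : seq I) (P : pred I) (f : V -> W) x
    (v : I -> V) : differentiable f x ->
  'D_(\sum_(i <- r | P i) v i) f x = \sum_(i <- r | P i) 'D_(v i) f x.
Proof.
by move=> df; rewrite deriveE// linear_sum; apply: eq_bigr => i _; rewrite deriveE.
Qed.

Lemma derive_comp (f : V -> V') (g : V' -> W) x v :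
  differentiable f x -> differentiable g (f x) ->
  'D_v (g \o f) x = 'D_('D_v f x) g (f x).
Proof.
move=> df dg; rewrite !deriveE//; last exact: differentiable_comp.
by rewrite diff_comp.
Qed.

Lemma derive_lin (f : {linear V -> W}) x v : continuous f -> 'D_v f x = f v.
Proof. by move=> cf; rewrite deriveE ?diff_lin//; exact: linear_differentiable. Qed.

End Directional.

(** * Closure properties of smooth functions *)

Section Ck.
Variables (R : realType).
Implicit Types (V : normedModType R).

(** Being C^k is local.  The functions [g] may vary with the point, which is
    needed to patch expressions written in different charts. *)
Lemma Ck_near V k (U : set V) (f : V -> R) :
  (forall x, U x -> exists W g,
     [/\ open W, W x, Ck k W g & forall y, W y -> f y = g y]) ->
  Ck k U f.
Proof.
elim: k f => [|k IH] f H /=.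
  move=> x /H[W [g [oW Wx /(_ _ Wx) cg fg]]].
  have nfg : \near x, g x = f x.
    by apply: filterS (near_open oW Wx) => y Wy; rewrite fg.
  rewrite /prop_for /continuous_at fg//; apply: cvg_trans cg.
  exact: near_eq_cvg.
split=> [x /H[W [g [oW Wx [dg _] fg]]]|v].
  apply: near_eq_differentiable (dg _ Wx).
  by apply: filterS (near_open oW Wx) => y Wy; rewrite fg.
apply: IH => x /H[W [g [oW Wx [_ Dg] fg]]]; exists W, (fun y => 'D_v g y).
split; [exact: oW|exact: Wx|exact: Dg|move=> y Wy; apply: near_eq_derive].
by apply: filterS (near_open oW Wy) => z; exact: fg.
Qed.

Lemma Ck_ext V k (U : set V) (f g : V -> R) : open U ->
  (forall x, U x -> f x = g x) -> Ck k U g -> Ck k U f.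
Proof. by move=> oU fg Cg; apply: Ck_near => x Ux; exists U, g. Qed.

Lemma Ck_sub V k (U W : set V) (f : V -> R) : W `<=` U -> Ck k U f -> Ck k W f.
Proof.
move=> sWU; elim: k f => [|k IH] f /= => [H x /sWU/H//|[df Df]].
by split=> [x /sWU/df//|v]; exact: IH.
Qed.

Lemma CkW V k (U : set V) (f : V -> R) : Ck k.+1 U f -> Ck k U f.
Proof.
elim: k f => [|k IH] f [df Df].
  by move=> x Ux; apply: differentiable_continuous; exact: df.
by split=> // v; apply: IH; exact: Df.
Qed.

Lemma CkD V k (U : set V) (f g : V -> R) : open U ->
  Ck k U f -> Ck k U g -> Ck k U (fun x => f x + g x).
Proof.
move=> oU; elim: k f g => [|k IH] f g.
  by move=> cf cg x Ux; apply: cvgD; [exact: cf|exact: cg].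
move=> [df Df] [dg Dg]; split=> [x Ux|v].
  by apply: differentiableD; [exact: df|exact: dg].
apply: (Ck_ext oU _ (IH _ _ (Df v) (Dg v))) => x Ux.
by apply: deriveD; apply: diff_derivable; [exact: df|exact: dg].
Qed.

Lemma CkM V k (U : set V) (f g : V -> R) : open U ->
  Ck k U f -> Ck k U g -> Ck k U (fun x => f x * g x).
Proof.
move=> oU; elim: k f g => [|k IH] f g.
  by move=> cf cg x Ux; apply: cvgM; [exact: cf|exact: cg].
move=> Cf Cg; have [df Df] := Cf; have [dg Dg] := Cg; split=> [x Ux|v].
  by apply: differentiableM; [exact: df|exact: dg].
apply: (Ck_ext oU _ (CkD oU (IH _ _ (CkW Cf) (Dg v)) (IH _ _ (CkW Cg) (Df v)))).
move=> x Ux; apply: deriveM; apply: diff_derivable; [exact: df|exact: dg].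
Qed.

Lemma Ck_cst V k (U : set V) (a : R) : Ck k U (fun=> a).
Proof.
elim: k a => [|k IH] a; first by move=> x _; exact: cvg_cst.
split=> [x _|v]; first exact: differentiable_cst.
have -> : (fun x => 'D_v (fun=> a) x) = (fun=> 0) by apply/funext => x; exact: derive_cst.
exact: IH.
Qed.

Lemma Ck_sum V k (U : set V) n (f : 'I_n -> V -> R) : open U ->
  (forall i, Ck k U (f i)) -> Ck k U (fun x => \sum_i f i x).
Proof.
move=> oU; elim: n f => [|n IH] f Cf.
  by apply: Ck_ext (Ck_cst k U 0) => // x _; rewrite big_ord0.
apply: (Ck_ext oU _ (CkD oU (IH _ (fun i => Cf (widen_ord (leqnSn n) i)))
  (Cf ord_max))) => x _.
by rewrite big_ord_recr.
Qed.

Lemma CkV V k (U : set V) (f : V -> R) : open U ->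
  (forall x, U x -> f x != 0) -> Ck k U f -> Ck k U (fun x => (f x)^-1).
Proof.
move=> oU f0; elim: k => [|k IH].
  by move=> cf x Ux; apply: cvgV; [exact: f0|exact: cf].
move=> Cf; have [df Df] := Cf; split=> [x Ux|v].
  by apply: differentiableV; [exact: df|exact: f0].
have Cfi := IH (CkW Cf).
apply: (Ck_ext oU _ (CkM oU (CkM oU (CkM oU (Ck_cst k U (-1)) Cfi) Cfi) (Df v))).
move=> x Ux; rewrite deriveV; [|exact: f0|exact/diff_derivable/df].
by rewrite mulN1r expr2 invfM mulNr.
Qed.

End Ck.

Section SmoothOn.
Variables (R : realType).
Implicit Types (V : normedModType R).

Lemma smooth_near V (U : set V) (f : V -> R) :
  (forall x, U x -> exists W g,
     [/\ open W, W x, smooth_on W g & forall y, W y -> f y = g y]) ->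
  smooth_on U f.
Proof.
move=> H k; apply: Ck_near => x /H[W [g [oW Wx sg fg]]].
by exists W, g; split=> //; exact: sg.
Qed.

Lemma smooth_ext V (U : set V) (f g : V -> R) : open U ->
  (forall x, U x -> f x = g x) -> smooth_on U g -> smooth_on U f.
Proof. by move=> oU fg sg k; apply: Ck_ext (sg k). Qed.

Lemma smooth_sub V (U W : set V) (f : V -> R) : W `<=` U ->
  smooth_on U f -> smooth_on W f.
Proof. by move=> sWU sf k; exact: Ck_sub (sf k). Qed.

Lemma smooth_differentiable V (U : set V) (f : V -> R) x :
  smooth_on U f -> U x -> differentiable f x.
Proof. by move=> /(_ 1%N)[df _]; exact: df. Qed.

Lemma smooth_derive V (U : set V) (f : V -> R) v :
  smooth_on U f -> smooth_on U (fun x => 'D_v f x).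
Proof. by move=> sf k; have [_] := sf k.+1; exact. Qed.

Lemma smoothD V (U : set V) (f g : V -> R) : open U ->
  smooth_on U f -> smooth_on U g -> smooth_on U (fun x => f x + g x).
Proof. by move=> oU sf sg k; apply: CkD. Qed.

Lemma smoothM V (U : set V) (f g : V -> R) : open U ->
  smooth_on U f -> smooth_on U g -> smooth_on U (fun x => f x * g x).
Proof. by move=> oU sf sg k; apply: CkM. Qed.

Lemma smooth_cst V (U : set V) (a : R) : smooth_on U (fun=> a).
Proof. by move=> k; exact: Ck_cst. Qed.

Lemma smoothV V (U : set V) (f : V -> R) : open U ->
  (forall x, U x -> f x != 0) -> smooth_on U f -> smooth_on U (fun x => (f x)^-1).
Proof. by move=> oU f0 sf k; apply: CkV. Qed.

Lemma smoothN V (U : set V) (f : V -> R) : open U ->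
  smooth_on U f -> smooth_on U (fun x => - f x).
Proof.
move=> oU sf; apply: smooth_ext (smoothM oU (smooth_cst U (-1)) sf) => //= x _.
by rewrite mulN1r.
Qed.

Lemma smooth_lin V (U : set V) (f : V -> R) : linear f -> continuous f ->
  smooth_on U f.
Proof.
move=> lf cf.
pose fM := GRing.isLinear.Build _ _ _ _ _ lf.
pose g : {linear V -> R} := HB.pack f fM.
have cg : continuous g := cf.
move=> [|k] /=; first by move=> x _; exact: cf.
split=> [x _|v]; first exact: (@linear_differentiable _ _ _ g).
have -> : (fun x => 'D_v f x) = (fun=> f v).
  by apply/funext => x; exact: (@derive_lin _ _ _ g).
exact: Ck_cst.
Qed.

(** Composition with a map given by its coordinates [phi i] along vectors [e i]. *)
(** By the chain rule, the derivative of the composite is a sum of products of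
    derivatives of the [phi i] with composites of directional derivatives of
    [g], to which the induction hypothesis applies.  Coordinates along arbitrary
    vectors [e i] serve both for maps into R and for maps into row vectors. *)
Lemma smooth_comp V V' n (e : 'I_n -> V') (phi : 'I_n -> V -> R)
    (U : set V') (W : set V) (g : V' -> R) :
  open W -> (forall i, smooth_on W (phi i)) -> smooth_on U g ->
  (forall x, W x -> U (\sum_i phi i x *: e i)) ->
  smooth_on W (fun x => g (\sum_i phi i x *: e i)).
Proof.
move=> oW sphi sg WU k; have := sg k; pose F x := \sum_i phi i x *: e i.
have FE : F = \sum_i (fun x => phi i x *: e i).
  by apply/funext => x; rewrite fct_sumE.
have dF x : W x -> differentiable F x.
  move=> Wx; rewrite FE; apply: differentiable_sum => i.
  exact/differentiableZl/(smooth_differentiable (sphi i)).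
elim: k g {sg} => [|k IH] g Cg.
  move=> x Wx; apply: (@continuous_comp _ _ _ F g); last exact: (Cg _ (WU _ Wx)).
  exact/differentiable_continuous/dF.
have [dg Dg] := Cg.
split=> [x Wx|v].
  by apply: (@differentiable_comp _ _ _ _ F g); [exact: dF|exact/dg/WU].
apply: (@Ck_ext _ _ _ _ _ (fun x => \sum_i 'D_v (phi i) x * 'D_(e i) g (F x))) => //.
  move=> x Wx; have dgx : differentiable g (F x) by exact/dg/WU.
  have dphi i := smooth_differentiable (sphi i) Wx.
  have DF : 'D_v F x = \sum_i 'D_v (phi i) x *: e i.
    rewrite FE derive_sum => [|i]; last exact/diff_derivable/differentiableZl.
    by apply: eq_bigr => i _; rewrite !deriveE ?diffZl//; exact: differentiableZl.
  rewrite (derive_comp _ (dF _ Wx) dgx) DF derive_sumdir//.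
  by apply: eq_bigr => i _; rewrite deriveZdir.
apply: Ck_sum => // i; apply: CkM => //; first exact: smooth_derive.
exact: (IH _ (Dg _)).
Qed.

End SmoothOn.

Section SmoothMaps.
Variables (R : realType).
Implicit Types (V : normedModType R).

Lemma differentiable_mx V m n (A : V -> 'M[R]_(m, n)) x :
  (forall i j, differentiable (fun y => A y i j) x) -> differentiable A x.
Proof.
move=> dA.
have -> : A = \sum_i \sum_j (fun y => A y i j *: delta_mx i j).
  apply/funext => y; rewrite fct_sumE {1}[A y]matrix_sum_delta.
  by apply: eq_bigr => i _; rewrite fct_sumE.
by do 2 apply: differentiable_sum => ?; exact: differentiableZl.
Qed.

Lemma derive_entry V m n (A : V -> 'M[R]_(m, n)) x a i j : differentiable A x ->
  ('D_a A x) i j = 'D_a (fun y => A y i j) x.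
Proof. by move=> dA; rewrite derive_mx ?mxE//; exact: diff_derivable. Qed.

Lemma smooth_map_differentiable V n (U : set V) (F : V -> 'rV[R]_n) x :
  smooth_map U F -> U x -> differentiable F x.
Proof.
move=> sF Ux; apply: differentiable_mx => i j; rewrite (ord1 i).
exact: smooth_differentiable (sF j) Ux.
Qed.

Lemma smooth_map_derive V n (U : set V) (F : V -> 'rV[R]_n) v : open U ->
  smooth_map U F -> smooth_map U (fun x => 'D_v F x).
Proof.
move=> oU sF j; apply: smooth_ext (smooth_derive v (sF j)) => // x Ux.
exact/derive_entry/(smooth_map_differentiable sF).
Qed.

Lemma smooth_comp_map V n (U : set 'rV[R]_n) (W : set V) (g : 'rV[R]_n -> R)
    (F : V -> 'rV[R]_n) : open W -> smooth_map W F -> smooth_on U g ->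
  (forall x, W x -> U (F x)) -> smooth_on W (fun x => g (F x)).
Proof.
move=> oW sF sg WU.
have E x : F x = \sum_j F x ord0 j *: delta_mx ord0 j by exact: row_sum_delta.
apply: (@smooth_ext _ _ _ _ (fun x => g (\sum_j F x ord0 j *: delta_mx ord0 j))) => //.
  by move=> x _; rewrite -E.
by apply: smooth_comp sg _ => // x Wx; rewrite -E; exact: WU.
Qed.

Lemma smooth_comp_real V (U : set R) (W : set V) (g : R -> R) (F : V -> R) :
  open W -> smooth_on W F -> smooth_on U g ->
  (forall x, W x -> U (F x)) -> smooth_on W (fun x => g (F x)).
Proof.
move=> oW sF sg WU.
have E x : F x = \sum_(j < 1) F x *: (1 : R).
  by rewrite big_ord1 -[RHS]/(_ * _) mulr1.
apply: (@smooth_ext _ _ _ _ (fun x => g (\sum_(j < 1) F x *: (1 : R)))) => //.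
  by move=> x _; rewrite -E.
have WU' x : W x -> U (\sum_(j < 1) F x *: (1 : R)) by rewrite -E; exact: WU.
exact: (@smooth_comp R V R 1 (fun=> 1) (fun=> F) U W g oW (fun=> sF) sg WU').
Qed.

Lemma smooth_coord n (U : set 'rV[R]_n) j : smooth_on U (fun u : 'rV[R]_n => u ord0 j).
Proof.
apply: smooth_lin; first by move=> a u v; rewrite !mxE.
exact: coord_continuous.
Qed.

Lemma smooth_hd n (U : set 'rV[R]_(1 + n)) : smooth_on U (@hd R n).
Proof.
have -> : @hd R n = fun u => u ord0 (lshift n ord0).
  by apply/funext => u; rewrite /hd mxE.
exact: smooth_coord.
Qed.

Lemma smooth_tl n (U : set 'rV[R]_(1 + n)) : smooth_map U (@tl R n).
Proof.
move=> j.
have -> : (fun u : 'rV[R]_(1 + n) => tl u ord0 j) = fun u => u ord0 (rshift 1 j).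
  by apply/funext => u; rewrite /tl mxE.
exact: smooth_coord.
Qed.

Lemma hd_cons n a (u : 'rV[R]_n) : hd (cons_rv a u) = a.
Proof. by rewrite /hd /cons_rv row_mxKl mxE mulr1n. Qed.

Lemma tl_cons n a (u : 'rV[R]_n) : tl (cons_rv a u) = u.
Proof. by rewrite /tl /cons_rv row_mxKr. Qed.

Lemma cons_hd_tl n (u : 'rV[R]_(1 + n)) : cons_rv (hd u) (tl u) = u.
Proof. by rewrite /cons_rv /hd /tl -mx11_scalar hsubmxK. Qed.

Lemma hdD n (u v : 'rV[R]_(1 + n)) : hd (u + v) = hd u + hd v.
Proof. by rewrite /hd !mxE. Qed.

Lemma tlD n (u v : 'rV[R]_(1 + n)) : tl (u + v) = tl u + tl v.
Proof. by apply/rowP => j; rewrite !mxE. Qed.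

Lemma hdZ n a (v : 'rV[R]_(1 + n)) : hd (a *: v) = a * hd v.
Proof. by rewrite /hd !mxE. Qed.

Lemma tlZ n a (v : 'rV[R]_(1 + n)) : tl (a *: v) = a *: tl v.
Proof. by apply/rowP => j; rewrite !mxE. Qed.

Lemma smooth_cons V n (U : set V) (a : V -> R) (F : V -> 'rV[R]_n) : open U ->
  smooth_on U a -> smooth_map U F -> smooth_map U (fun x => cons_rv (a x) (F x)).
Proof.
move=> oU sa sF j; rewrite /cons_rv.
case: (splitP j) => k jk.
  have -> : j = lshift n k by exact/val_inj.
  apply: smooth_ext sa => // x _.
  by rewrite row_mxEl mxE (ord1 k) mulr1n.
have -> : j = rshift 1 k by exact/val_inj.
by apply: smooth_ext (sF k) => // x _; rewrite row_mxEr.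
Qed.

Lemma derive_real (g : R -> R) t v : differentiable g t -> 'D_v g t = v * 'D_1 g t.
Proof.
move=> dg.
apply: (eq_trans (congr1 (fun z => 'D_z g t) (esym (mulr1 v : v *: (1 : R) = v)))).
exact: deriveZdir.
Qed.

(** The derivative of [P] in direction [v] is [v * k], so [P] is C^(n+1) as soon
    as [k] is C^n. *)
Lemma smooth_primitive (U : set R) (P k : R -> R) : open U ->
  (forall t, U t -> is_derive t 1 P (k t)) -> smooth_on U k -> smooth_on U P.
Proof.
move=> oU dP sk.
have dfP t : U t -> differentiable P t by move=> /dP[/derivable1_diffP].
case=> [|n]; first by move=> t /dfP; exact: differentiable_continuous.
split=> // v; apply: Ck_ext (CkM oU (Ck_cst n U v) (sk n)) => // t Ut.
by rewrite (derive_real v (dfP _ Ut)) (@derive_val _ _ _ _ _ _ _ (dP _ Ut)).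
Qed.

End SmoothMaps.

(** * Symmetry of second derivatives *)

Section Schwarz.
Variables (R : realType) (V : normedModType R).
Implicit Types (f : V -> R) (x y v w : V).

Lemma is_derive_line f v y (a : R) : differentiable f (a *: v + y) ->
  is_derive a 1 (fun a : R => f (a *: v + y)) ('D_v f (a *: v + y)).
Proof.
move=> df.
pose l (b : R) := b *: v + y.
have dl : differentiable l a.
  by apply: differentiableD; [exact: differentiableZl|exact: differentiable_cst].
have Dl : 'D_1 l a = v.
  rewrite /l deriveD ?derive_cst ?addr0; last 2 first.
  - exact/diff_derivable/differentiableZl.
  - exact: derivable_cst.
  by rewrite deriveE ?diffZl ?diff_val ?scale1r//; exact: differentiableZl.
split; first exact/diff_derivable/(differentiable_comp dl).
by rewrite -[X in 'D_X f _]Dl -(derive_comp _ dl).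
Qed.

(** Two applications of the mean value theorem, first to the increment of [f]
    in direction [w] as a function on the segment along [v], then to the
    derivative of [f] along [v] as a function on the segment along [w]. *)
Lemma second_difference (U : set V) f v w x (tau : R) : 0 < tau ->
  smooth_on U f ->
  (forall a b, 0 <= a <= tau -> 0 <= b <= tau -> U (a *: v + (b *: w + x))) ->
  exists a b, [/\ 0 <= a <= tau, 0 <= b <= tau &
    f (tau *: v + (tau *: w + x)) - f (tau *: v + x) - f (tau *: w + x) + f x =
    tau ^+ 2 * 'D_w (fun y => 'D_v f y) (a *: v + (b *: w + x))].
Proof.
move=> tau0 sf Uf.
have t0 : 0 <= (0:R) <= tau by rewrite lexx ltW.
have tt : 0 <= tau <= tau by rewrite lexx ltW.
pose g a := f (a *: v + (tau *: w + x)) - f (a *: v + x).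
have dg a : 0 <= a <= tau ->
    is_derive a 1 g ('D_v f (a *: v + (tau *: w + x)) - 'D_v f (a *: v + x)).
  move=> ha; apply: is_deriveB; apply: is_derive_line;
    apply: (smooth_differentiable sf).
    exact: Uf.
  by have := Uf a 0 ha t0; rewrite scale0r add0r.
have sub c : c \in `]0, tau[%R -> 0 <= c <= tau.
  by rewrite in_itv /= => /andP[? ?]; rewrite !ltW.
have cont (k dk : R -> R) : (forall a, 0 <= a <= tau -> is_derive a 1 k (dk a)) ->
    {within `[0, tau], continuous k}.
  move=> dk'; apply: derivable_within_continuous => a; rewrite in_itv /= => ha.
  by case: (dk' _ ha).
have [c /sub hc gE] := MVT tau0 (fun a ha => dg a (sub a ha)) (cont _ _ dg).
pose k b := 'D_v f (c *: v + (b *: w + x)).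
have dk b : 0 <= b <= tau ->
    is_derive b 1 k ('D_w (fun y => 'D_v f y) (c *: v + (b *: w + x))).
  move=> hb.
  have kE b' : k b' = 'D_v f (b' *: w + (c *: v + x)) by rewrite /k addrCA.
  have -> : k = fun b' => 'D_v f (b' *: w + (c *: v + x)) by exact/funext.
  rewrite addrCA; apply: (@is_derive_line (fun y => 'D_v f y)).
  apply: (smooth_differentiable (smooth_derive v sf)).
  by rewrite addrCA; exact: Uf.
have [d /sub hd kE] := MVT tau0 (fun a ha => dk a (sub a ha)) (cont _ _ dk).
exists c, d; split=> //.
have -> : tau ^+ 2 = tau * tau by [].
rewrite subr0 in gE; rewrite subr0 in kE.
rewrite -mulrA [X in tau * X]mulrC -kE /k scale0r add0r mulrC -gE /g.
by rewrite !scale0r !add0r opprB [RHS]addrA [LHS]addrAC.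
Qed.

(** The second difference is symmetric in [v] and [w], so some value of each
    mixed derivative near [x] equals the other; both are continuous at [x]. *)
Lemma schwarz (U : set V) f v w x : open U -> smooth_on U f -> U x ->
  'D_w (fun y => 'D_v f y) x = 'D_v (fun y => 'D_w f y) x.
Proof.
move=> oU sf Ux.
pose A (y : V) : R := 'D_w (fun y => 'D_v f y) y; pose B (y : V) : R := 'D_v (fun y => 'D_w f y) y.
change (A x = B x); apply/eqP; rewrite -subr_eq0 -normr_le0.
apply/ler_addgt0Pl => e e0; rewrite addr0.
have e20 : 0 < e / 2 by rewrite divr_gt0.
have nA : \forall y \near x, `|A x - A y| < e / 2.
  apply: ((cvgrPdist_lt _ _).1 _ _ e20).
  apply/differentiable_continuous.
  exact: (smooth_differentiable (smooth_derive w (smooth_derive v sf)) Ux).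
have nB : \forall y \near x, `|B x - B y| < e / 2.
  apply: ((cvgrPdist_lt _ _).1 _ _ e20).
  apply/differentiable_continuous.
  exact: (smooth_differentiable (smooth_derive v (smooth_derive w sf)) Ux).
have /nbhs_ballP[r /= r0 xr] :
    nbhs x (U `&` ([set y | `|A x - A y| < e / 2] `&` [set y | `|B x - B y| < e / 2])).
  apply: filterI; first exact: near_open.
  by apply: filterI; [exact: nA|exact: nB].
(* The parallelogram with sides [tau *: v] and [tau *: w] at [x] lies in the ball. *)
pose K := `|v| + `|w| + 1.
have K0 : 0 < K by rewrite ltr_wpDl// addr_ge0.
pose tau := r / 2 / K.
have tau0 : 0 < tau by rewrite !divr_gt0.
have inb a b : 0 <= a <= tau -> 0 <= b <= tau -> ball x r (a *: v + (b *: w + x)).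
  move=> /andP[a0 at_] /andP[b0 bt]; rewrite -ball_normE /= addrA opprD addrCA subrr addr0 normrN.
  apply: (le_lt_trans (ler_normD _ _)); rewrite !normrZ !ger0_norm//.
  apply: (@le_lt_trans _ _ (tau * K)).
    rewrite /K !mulrDr mulr1; apply: ler_wpDr; first exact: ltW.
    by rewrite lerD// ler_wpM2r.
  by rewrite /tau divfK ?gt_eqF// ltr_pdivrMr// ltr_pMr// ltr1n.
have inU a b : 0 <= a <= tau -> 0 <= b <= tau -> U (a *: v + (b *: w + x)).
  by move=> ha hb; have [] := xr _ (inb a b ha hb).
have [a [b [ha hb E1]]] := second_difference tau0 sf inU.
have inU' c d : 0 <= c <= tau -> 0 <= d <= tau -> U (c *: w + (d *: v + x)).
  by move=> ha' hb'; rewrite addrCA; exact: inU.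
have [c [d [hc hd E2]]] := second_difference tau0 sf inU'.
have E : A (a *: v + (b *: w + x)) = B (c *: w + (d *: v + x)).
  apply: (@mulfI _ (tau ^+ 2)); first by rewrite expf_neq0// gt_eqF.
  apply: (eq_trans (esym E1)); apply: (eq_trans _ E2).
  rewrite [tau *: w + (tau *: v + x)]addrCA.
  exact: (congr1 (fun z => z + _) (addrAC _ _ _)).
have [_ [/= h1 _]] := xr _ (inb a b ha hb).
have [_ [_ /= ]] := xr _ (inb d c hd hc); rewrite addrCA -E => h2.
(* Hiding the bodies keeps unification from unfolding the derivatives. *)
clear E1 E2; clearbody A B.
have h3 : `|A x - B x| <= `|A x - A (a *: v + (b *: w + x))|
    + `|A (a *: v + (b *: w + x)) - B x| by exact: ler_distD.
rewrite (le_trans h3)// [leRHS]splitr; apply: lerD; first exact: ltW.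
by rewrite distrC ltW.
Qed.

End Schwarz.

(* Otherwise unification unfolds derivatives into limits when it fails. *)
Local Opaque derive.

(** * Bilinear forms given by matrices *)

Section InnerProduct.
Variables (R : realType) (n : nat).
Implicit Types (A B : 'M[R]_n) (u v w : 'rV[R]_n).

Lemma ipE A v w : ip A v w = \sum_i \sum_j v ord0 i * A i j * w ord0 j.
Proof.
rewrite /ip mxE exchange_big /=; apply: eq_bigr => j _.
by rewrite !mxE big_distrl.
Qed.

Lemma ipDl A u v w : ip A (u + v) w = ip A u w + ip A v w.
Proof. by rewrite /ip !mulmxDl mxE. Qed.

Lemma ipDr A u v w : ip A u (v + w) = ip A u v + ip A u w.
Proof. by rewrite /ip linearD /= mulmxDr mxE. Qed.

Lemma ipZl A a v w : ip A (a *: v) w = a * ip A v w.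
Proof. by rewrite /ip -!scalemxAl mxE. Qed.

Lemma ipZr A a v w : ip A v (a *: w) = a * ip A v w.
Proof. by rewrite /ip linearZ /= -scalemxAr mxE. Qed.

Lemma ipDm A B v w : ip (A + B) v w = ip A v w + ip B v w.
Proof. by rewrite /ip mulmxDr mulmxDl mxE. Qed.

Lemma ipZm a A v w : ip (a *: A) v w = a * ip A v w.
Proof. by rewrite /ip -scalemxAr -scalemxAl mxE. Qed.

Lemma ip0l A w : ip A 0 w = 0.
Proof. by rewrite /ip !mul0mx mxE. Qed.

Lemma ip0r A w : ip A w 0 = 0.
Proof. by rewrite /ip trmx0 mulmx0 mxE. Qed.

Lemma ip0m v w : ip 0 v w = 0.
Proof. by rewrite /ip mulmx0 mul0mx mxE. Qed.

Lemma ip_sumr A v (I : Type) (r : seq I) (w : I -> 'rV[R]_n) :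
  ip A v (\sum_(i <- r) w i) = \sum_(i <- r) ip A v (w i).
Proof. by elim/big_rec2: _ => [|i y1 y2 _ <-]; rewrite ?ip0r ?ipDr. Qed.

Lemma ip_summ v w (I : Type) (r : seq I) (A : I -> 'M[R]_n) :
  ip (\sum_(i <- r) A i) v w = \sum_(i <- r) ip (A i) v w.
Proof. by elim/big_rec2: _ => [|i y1 y2 _ <-]; rewrite ?ip0m ?ipDm. Qed.

Lemma ip_sym A v w : A^T = A -> ip A v w = ip A w v.
Proof.
move=> sA; rewrite /ip.
have <- : (v *m A *m w^T)^T = w *m A *m v^T by rewrite !trmx_mul trmxK sA mulmxA.
by rewrite [RHS]mxE.
Qed.

Lemma ip_invmx A u w : A \in unitmx ->
  ip A (u *m invmx A) w = (u *m w^T) ord0 ord0.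
Proof. by move=> uA; rewrite /ip mulmxKV. Qed.

Lemma nondegenerate_unitmx A : (forall v, v *m A = 0 -> v = 0) -> A \in unitmx.
Proof.
move=> H; rewrite -row_free_unit -kermx_eq0; apply/eqP/row_matrixP => i.
by rewrite row0; apply: H; apply/sub_kermxP; exact: row_sub.
Qed.

End InnerProduct.

Section DeriveIp.
Variables (R : realType) (V : normedModType R).

Lemma is_derive_ip n (A : V -> 'M[R]_n) (v w : V -> 'rV[R]_n) x a :
  differentiable A x -> differentiable v x -> differentiable w x ->
  is_derive x a (fun y => ip (A y) (v y) (w y))
    (ip ('D_a A x) (v x) (w x) + ip (A x) ('D_a v x) (w x)
     + ip (A x) (v x) ('D_a w x)).
Proof.
move=> dA dv dw.
have coord p q (B : V -> 'M[R]_(p, q)) i j : differentiable B x ->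
    is_derive x a (fun y => B y i j) (('D_a B x) i j).
  move=> dB; rewrite derive_entry//; apply: derivableP.
  exact: ((derivable_mxP _ _ _).1 (diff_derivable dB)).
have -> : (fun y => ip (A y) (v y) (w y)) =
    \sum_i \sum_j (fun y => v y ord0 i * A y i j * w y ord0 j).
  apply/funext => y; rewrite ipE fct_sumE.
  by apply: eq_bigr => i _; rewrite fct_sumE.
have D i j : is_derive x a (fun y => v y ord0 i * A y i j * w y ord0 j)
    (v x ord0 i * ('D_a A x) i j * w x ord0 j +
     ('D_a v x) ord0 i * A x i j * w x ord0 j +
     v x ord0 i * A x i j * ('D_a w x) ord0 j).
  apply: is_derive_eq (is_deriveM (is_deriveM (coord _ _ _ _ _ dv)
    (coord _ _ _ _ _ dA)) (coord _ _ _ _ _ dw)) _.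
  have sE (c d : R) : c *: d = c * d by [].
  by rewrite !sE fctE; ring.
apply: is_derive_eq (is_derive_sum (fun i => is_derive_sum (D i))) _.
by rewrite !ipE -!big_split; apply: eq_bigr => i _; rewrite -!big_split.
Qed.

End DeriveIp.

(** * The covariant derivative of a gradient field *)

Section LeviCivita.
Variables (R : realType) (n : nat).
Implicit Types (G : 'rV[R]_n -> 'M[R]_n) (x X Y Z : 'rV[R]_n).

Lemma derive_ip_cst G x a v w : differentiable G x ->
  'D_a (fun y => ip (G y) v w) x = ip ('D_a G x) v w.
Proof.
move=> dG.
have D := @is_derive_ip R _ n G (cst v) (cst w) x a dG
  (differentiable_cst v x) (differentiable_cst w x).
by rewrite (@derive_val _ _ _ _ _ _ _ D) !derive_cst ip0l ip0r !addr0.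
Qed.

Lemma christoffel1E G x X Z Y : differentiable G x ->
  (christoffel1 G x X Z *m Y^T) ord0 ord0 =
  2^-1 * (ip ('D_X G x) Z Y + ip ('D_Z G x) X Y - ip ('D_Y G x) X Z).
Proof.
move=> dG.
have sumY M V : ip M V Y = \sum_l Y ord0 l * ip M V (delta_mx ord0 l).
  rewrite [in LHS](row_sum_delta Y) ip_sumr.
  by apply: eq_bigr => l _; rewrite ipZr.
have sumD : ip ('D_Y G x) X Z = \sum_l Y ord0 l * ip ('D_(delta_mx ord0 l) G x) X Z.
  rewrite [in LHS](row_sum_delta Y) derive_sumdir// ip_summ.
  by apply: eq_bigr => l _; rewrite deriveZdir// ipZm.
transitivity (\sum_l 2^-1 * (ip ('D_X G x) Z (delta_mx ord0 l) +
    ip ('D_Z G x) X (delta_mx ord0 l) - ip ('D_(delta_mx ord0 l) G x) X Z) * Y ord0 l).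
  by rewrite mxE; apply: eq_bigr => l _; rewrite !mxE !derive_ip_cst.
have sumE (p q r : 'I_n -> R) : \sum_l 2^-1 * (p l + q l - r l) * Y ord0 l =
    2^-1 * (\sum_l Y ord0 l * p l + \sum_l Y ord0 l * q l - \sum_l Y ord0 l * r l).
  by rewrite -big_split -sumrB big_distrr; apply: eq_bigr => l _ /=; ring.
transitivity (2^-1 * (\sum_l Y ord0 l * ip ('D_X G x) Z (delta_mx ord0 l) +
    \sum_l Y ord0 l * ip ('D_Z G x) X (delta_mx ord0 l) -
    \sum_l Y ord0 l * ip ('D_(delta_mx ord0 l) G x) X Z)); first exact: sumE.
congr (_ * (_ + _ - _)); [exact/esym/sumY|exact/esym/sumY|exact/esym].
Qed.

(** Symmetry of the Hessian of [h] gives g(nabla_X xi, Y) = g(nabla_Y xi, X), and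
    the sum of both sides is (L_xi g)(X, Y) for every vector field [xi].  The right-hand
    side is half of this Lie derivative for constant [X] and [Y]. *)
Lemma nabla_gradient G (U : set 'rV[R]_n) h xi x X Y :
  open U -> U x -> smooth_on U h -> differentiable G x -> differentiable xi x ->
  G x \in unitmx -> (forall y, U y -> (G y)^T = G y) ->
  (forall y Z, U y -> ip (G y) (xi y) Z = 'D_Z h y) ->
  ip (G x) (nabla G xi x X) Y =
  2^-1 * (ip ('D_(xi x) G x) X Y + ip (G x) ('D_X xi x) Y
          + ip (G x) X ('D_Y xi x)).
Proof.
move=> oU Ux sh dG dxi uG sG gradE.
have hess a b : 'D_a (fun y => 'D_b h y) x =
    ip ('D_a G x) (xi x) b + ip (G x) ('D_a xi x) b.
  have D := @is_derive_ip R _ n G xi (cst b) x a dG dxi (differentiable_cst b x).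
  rewrite -(near_eq_derive (f := fun y => ip (G y) (xi y) b)); last first.
    by apply: filterS (near_open oU Ux) => y; exact: gradE.
  by rewrite (@derive_val _ _ _ _ _ _ _ D) derive_cst ip0r addr0.
have := schwarz X Y oU sh Ux; rewrite !hess => S.
have sdG a v w : ip ('D_a G x) v w = ip ('D_a G x) w v.
  rewrite -!derive_ip_cst//; apply: near_eq_derive.
  by apply: filterS (near_open oU Ux) => y Uy; rewrite ip_sym// sG.
have S' : ip ('D_X G x) (xi x) Y + ip (G x) ('D_X xi x) Y =
    ip ('D_Y G x) X (xi x) + ip (G x) X ('D_Y xi x).
  apply: (eq_trans (esym S)); congr (_ + _); first exact: sdG.
  exact: ip_sym (sG _ Ux).
(* Here [p1], [p2], [p3] stand for the three derivatives of the metric in the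
   Christoffel symbol, [q1] and [q2] for the two derivatives of [xi]. *)
have koszul (p1 p2 p3 q1 q2 : R) : p1 + q1 = p3 + q2 ->
    q1 + 2^-1 * (p1 + p2 - p3) = 2^-1 * (p2 + q1 + q2).
  by move=> E; have -> : q2 = p1 + q1 - p3 by [rewrite E addrAC subrr add0r]; field.
rewrite /nabla ipDl ip_invmx// christoffel1E//.
exact: koszul S'.
Qed.

(** Naturality of the Lie derivative under [Phi].  Its derivative terms vanish
    upstairs, because [xi] corresponds under [Phi] to the constant vector [a] on
    the lines through [p] in the directions [v] and [w].  What remains is the
    derivative along [a] of the pulled back metric. *)
Lemma lie_derivative_pullback G (U Q : set 'rV[R]_n) xi Phi p a v w :
  open Q -> Q p -> smooth_map Q Phi -> smooth_map U xi -> U (Phi p) ->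
  differentiable G (Phi p) ->
  xi (Phi p) = 'D_a Phi p ->
  (\forall t \near (0 : R), xi (Phi (t *: v + p)) = 'D_a Phi (t *: v + p)) ->
  (\forall t \near (0 : R), xi (Phi (t *: w + p)) = 'D_a Phi (t *: w + p)) ->
  ip ('D_(xi (Phi p)) G (Phi p)) ('D_v Phi p) ('D_w Phi p)
  + ip (G (Phi p)) ('D_('D_v Phi p) xi (Phi p)) ('D_w Phi p)
  + ip (G (Phi p)) ('D_v Phi p) ('D_('D_w Phi p) xi (Phi p)) =
  'D_a (fun q => ip (G (Phi q)) ('D_v Phi q) ('D_w Phi q)) p.
Proof.
move=> oQ Qp sPhi sxi Ux dG xip nv nw.
have dPhi := smooth_map_differentiable sPhi Qp.
have dxi := smooth_map_differentiable sxi Ux.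
have dD b : differentiable (fun q => 'D_b Phi q) p.
  exact: smooth_map_differentiable (smooth_map_derive b oQ sPhi) Qp.
(* Both sides are second derivatives of [Phi], in the directions [a] and [b]. *)
have swap b : (\forall t \near (0 : R), xi (Phi (t *: b + p)) = 'D_a Phi (t *: b + p)) ->
    'D_('D_b Phi p) xi (Phi p) = 'D_a (fun q => 'D_b Phi q) p.
  move=> nb.
  have coordE c q j : Q q -> ('D_c Phi q) ord0 j = 'D_c (fun y => Phi y ord0 j) q.
    by move=> Qq; apply: derive_entry; exact: smooth_map_differentiable sPhi Qq.
  have coordE2 c d j : ('D_c (fun q => 'D_d Phi q) p) ord0 j =
      'D_c (fun q => 'D_d (fun y => Phi y ord0 j) q) p.
    apply: (eq_trans (derive_entry _ _ _ (dD d))); apply: near_eq_derive.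
    by apply: filterS (near_open oQ Qp) => q; exact: coordE.
  apply: (eq_trans (esym (derive_comp b dPhi dxi))).
  apply: (eq_trans (@near_line_derive _ _ _ (xi \o Phi) (fun q => 'D_a Phi q) p b nb)).
  apply/rowP => j.
  exact: (eq_trans (coordE2 _ _ _) (eq_trans (schwarz _ _ oQ (sPhi j) Qp) (esym (coordE2 _ _ _)))).
have D := is_derive_ip a (differentiable_comp dPhi dG) (dD v) (dD w).
have dGPhi : 'D_a (G \o Phi) p = 'D_(xi (Phi p)) G (Phi p).
  apply: (eq_trans (derive_comp a dPhi dG)).
  exact: (congr1 (fun z => 'D_z G (Phi p)) (esym xip)).
apply: (eq_trans _ (esym (@derive_val _ _ _ _ _ _ _ D))).
have e1 := congr1 (fun M => ip M ('D_v Phi p) ('D_w Phi p)) (esym dGPhi).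
have e2 := congr1 (fun z => ip (G (Phi p)) z ('D_w Phi p)) (swap v nv).
have e3 := congr1 (fun z => ip (G (Phi p)) ('D_v Phi p) z) (swap w nw).
exact: (f_equal2 +%R (f_equal2 +%R e1 e2) e3).
Qed.

End LeviCivita.

(** * Primitives on an open interval *)

Section OrientedIntegral.
Variables (R : realType) (I : set R) (k : R -> R).
Hypotheses (I_interval : open_interval I).
Hypothesis (k_cont : forall t, I t -> {for t, continuous k}).
Implicit Types (a b t x : R).

Lemma oriented_integral_refl a : oriented_integral k a a = 0.
Proof. by rewrite /oriented_integral lexx set_itv1 Rintegral_set1. Qed.

Lemma oriented_integralN a b : oriented_integral k a b = - oriented_integral k b a.
Proof.
rewrite /oriented_integral; case: (ltgtP a b) => [||->]; rewrite ?opprK//.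
by rewrite set_itv1 Rintegral_set1 oppr0.
Qed.

Lemma open_interval_around t : I t -> exists a b, [/\ I a, I b, a < t & t < b].
Proof.
case: I_interval => oI _ _ It.
have /nbhs_ballP[e /= e0 eI] := near_open oI It.
have e20 : 0 < e / 2 by rewrite divr_gt0.
have e2e : e / 2 < e by rewrite ltr_pdivrMr// ltr_pMr// ltr1n.
exists (t - e / 2), (t + e / 2); split.
- by apply: eI; rewrite /= -ball_normE /= opprB addrC subrK gtr0_norm.
- by apply: eI; rewrite /= -ball_normE /= opprD addrA subrr add0r normrN gtr0_norm.
- by rewrite ltrBlDr ltrDl.
- by rewrite ltrDl.
Qed.

(** The fundamental theorem of calculus applies to integrals from a fixed left
    end point; choosing it in [I] below both [t] and [t0] turns the oriented
    integral into a difference of two such integrals, on either side of [t0]. *)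
Lemma is_derive_oriented_integral t0 t : I t0 -> I t ->
  is_derive t 1 (oriented_integral k t0) (k t).
Proof.
move=> It0 It.
have [a1 [b1 [Ia1 Ib1 a1t b1t]]] := open_interval_around It.
have [a0 [b0 [Ia0 Ib0 a0t b0t]]] := open_interval_around It0.
have [a [Ia at_ at0]] : exists a, [/\ I a, a < t & a < t0].
  by case: (ltP a0 a1) => h; [exists a0|exists a1]; split=> //;
    [exact: lt_trans h _|exact: le_lt_trans h _].
have [b [Ib tb t0b]] : exists b, [/\ I b, t < b & t0 < b].
  by case: (ltP b0 b1) => h; [exists b1|exists b0]; split=> //;
    [exact: lt_trans h|exact: lt_le_trans h].
have [_ intI _] := I_interval.
have abI x : a <= x <= b -> I x by exact: intI.
have integrable_k x : x <= b ->
    (@lebesgue_measure R).-integrable `[a, x] (EFin \o k).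
  move=> xb; apply: continuous_compact_integrable; first exact: segment_compact.
  apply: continuous_in_subspaceT => y; rewrite inE /= in_itv /= => /andP[ay yx].
  by apply: k_cont; apply: abI; rewrite ay (le_trans yx).
pose F x : R := \int[lebesgue_measure]_(r in `[a, x]) k r.
have additive x y : a <= x -> x <= y -> y <= b ->
    F y - F x = \int[lebesgue_measure]_(r in `[x, y]) k r.
  move=> ax xy yb; rewrite /F Rintegral_itvB//; last exact: integrable_k.
  rewrite Rintegral_itv_obnd_cbnd//.
  by apply: integrableS (integrable_k _ yb) => //; apply: subset_itvr; rewrite bnd_simp.
have FE x : a < x -> x < b -> F x - F t0 = oriented_integral k t0 x.
  move=> ax xb; rewrite /oriented_integral; case: leP => h.
    by rewrite additive// ltW.
  by rewrite -additive ?opprB// ltW.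
have [dF F'] := continuous_FTC1_closed tb (integrable_k _ (lexx b)) at_ (k_cont It).
have DF : is_derive t 1 (fun x => F x - F t0) (k t).
  have -> : k t = k t - 0 by rewrite subr0.
  apply: (@is_deriveB _ _ _ F (cst (F t0))).
  by split; [exact: dF|exact: (eq_trans (esym (derive1E _ _)) F')].
apply: near_eq_is_derive DF.
have tab : t \in `]a, b[ by rewrite in_itv /= at_ tb.
apply: filterS (near_in_itvoo tab) => x.
by rewrite in_itv /= => /andP[ax xb]; exact: FE.
Qed.

End OrientedIntegral.

(** * Orthonormal bases of a positive definite form *)

Section Orthonormal.
Variable R : realType.

Lemma ip_congr n p (A : 'M[R]_n) (T : 'M[R]_(p, n)) v w :
  ip (T *m A *m T^T) v w = ip A (v *m T) (w *m T).
Proof. by rewrite /ip trmx_mul !mulmxA. Qed.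

Lemma ip_row n p (A : 'M[R]_n) (T : 'M[R]_(p, n)) i j :
  ip A (row i T) (row j T) = (T *m A *m T^T) i j.
Proof.
rewrite -[row i T]mul1mx -[row j T]mul1mx.
by rewrite !rowE !mul1mx -ip_congr /ip trmx_delta -rowE -colE !mxE.
Qed.

(** The rows of [P] are an orthonormal basis.  Induction on the dimension: the
    unipotent matrix [T] clears the first row and column of [A] up to the
    corner [a], and leaves the Schur complement [C'], again positive
    definite. *)
Lemma posdef_orthonormal n (A : 'M[R]_n) : A^T = A ->
  (forall v, v != 0 -> 0 < ip A v v) -> exists P : 'M[R]_n, P *m A *m P^T = 1%:M.
Proof.
elim: n A => [|n IH] A sA pA; first by exists 0; apply/matrixP => -[].
rewrite -[n.+1]/(1 + n)%N in A sA pA *.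
pose a := ulsubmx A ord0 ord0; pose b := ursubmx A; pose C := drsubmx A.
have AE : A = block_mx a%:M b b^T C.
  rewrite -[LHS]submxK /a -mx11_scalar; congr block_mx.
  by rewrite trmx_ursub sA.
have a0 : 0 < a.
  have /pA : row_mx 1%:M (0 : 'rV[R]_n) != 0.
    apply/eqP => /(congr1 lsubmx); rewrite row_mxKl linear0.
    by move=> /matrixP/(_ ord0 ord0)/eqP; rewrite !mxE oner_eq0.
  by rewrite AE /ip tr_row_mx mul_row_block mul_row_col !mul1mx !mul0mx trmx1 trmx0
    mulmx1 mulmx0 !addr0 mxE mulr1n.
have aK : a * a^-1 = 1 by rewrite mulfV// gt_eqF.
pose T : 'M[R]_(1 + n) := block_mx 1%:M 0 (- a^-1 *: b^T) 1%:M.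
pose C' := C - a^-1 *: (b^T *m b).
have TAT : T *m A *m T^T = block_mx a%:M 0 0 C'.
  rewrite /T AE tr_block_mx !mulmx_block !trmx1 !trmx0 linearZ /= trmxK.
  rewrite !mul1mx !mul0mx !mulmx1 !mulmx0 !addr0 mul_mx_scalar scalerA.
  rewrite mulrN aK scaleN1r addNr mul0mx add0r -scalemxAr mul_scalar_mx scalerA.
  rewrite mulNr mulrC aK scaleN1r addNr; congr block_mx.
  by rewrite -scalemxAl scaleNr addrC.
have sC' : C'^T = C'.
  have : (T *m A *m T^T)^T = T *m A *m T^T by rewrite !trmx_mul trmxK sA mulmxA.
  by rewrite TAT tr_block_mx => /eq_block_mx[].
have pC' w : w != 0 -> 0 < ip C' w w.
  move=> w0; pose v : 'rV[R]_(1 + n) := row_mx 0 w.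
  have -> : ip C' w w = ip A (v *m T) (v *m T).
    rewrite -ip_congr TAT /ip tr_row_mx mul_row_block mul_row_col.
    by rewrite !trmx0 !mul0mx !mulmx0 !add0r.
  apply: pA; apply: contra w0 => /eqP.
  rewrite /v /T mul_row_block !mul0mx !add0r mulmx1 => /(congr1 rsubmx).
  by rewrite row_mxKr linear0 => ->.
have [P' P'E] := IH C' sC' pC'.
pose B : 'M[R]_(1 + n) := block_mx (Num.sqrt a)^-1%:M 0 0 P'.
exists (B *m T).
have -> : B *m T *m A *m (B *m T)^T = B *m (T *m A *m T^T) *m B^T.
  by rewrite trmx_mul !mulmxA.
rewrite TAT tr_block_mx !mulmx_block !trmx0 !mul0mx !mulmx0 !addr0 !add0r.
rewrite ?mul0mx ?mulmx0 ?addr0 ?add0r P'E tr_scalar_mx -!scalar_mxM.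
have s0 : Num.sqrt a != 0 by rewrite gt_eqF ?sqrtr_gt0.
have -> : (Num.sqrt a)^-1 * a * (Num.sqrt a)^-1 = 1.
  by rewrite -{2}(sqr_sqrtr (ltW a0)); field.
by rewrite -scalar_mx_block.
Qed.

Lemma orthonormal_span n (A P : 'M[R]_n) (v : 'rV[R]_n) :
  P *m A *m P^T = 1%:M -> exists a : 'I_n -> R, v = \sum_i a i *: row i P.
Proof.
rewrite -mulmxA => /mulmx1_unit[uP _].
exists (fun i => (v *m invmx P) ord0 i).
by rewrite -[LHS](mulmxKV uP) mulmx_sum_row.
Qed.

End Orthonormal.

(** * Calculus of split row vectors *)

Section HeadTail.
Variables (R : realType) (n : nat) (V : normedModType R).

Lemma differentiable_hd (u : 'rV[R]_(1 + n)) : differentiable (@hd R n) u.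
Proof. exact: (smooth_differentiable (smooth_hd setT)). Qed.

Lemma differentiable_tl (u : 'rV[R]_(1 + n)) : differentiable (@tl R n) u.
Proof. exact: (smooth_map_differentiable (@smooth_tl R n setT)). Qed.

Lemma derive_hd (u v : 'rV[R]_(1 + n)) : 'D_v (@hd R n) u = hd v.
Proof.
have l : linear (@hd R n) by move=> a x y; rewrite hdD hdZ.
pose fM := GRing.isLinear.Build _ _ _ _ _ l.
pose g : {linear 'rV[R]_(1 + n) -> R} := HB.pack (@hd R n) fM.
apply: (@derive_lin _ _ _ g) => x.
exact/differentiable_continuous/differentiable_hd.
Qed.

Lemma derive_tl (u v : 'rV[R]_(1 + n)) : 'D_v (@tl R n) u = tl v.
Proof.
have l : linear (@tl R n) by move=> a x y; rewrite tlD tlZ.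
pose fM := GRing.isLinear.Build _ _ _ _ _ l.
pose g : {linear 'rV[R]_(1 + n) -> 'rV[R]_n} := HB.pack (@tl R n) fM.
apply: (@derive_lin _ _ _ g) => x.
exact/differentiable_continuous/differentiable_tl.
Qed.

Lemma derive_comp_hd (W : normedModType R) (g : R -> W) (u v : 'rV[R]_(1 + n)) :
  differentiable g (hd u) -> 'D_v (fun y => g (hd y)) u = 'D_(hd v) g (hd u).
Proof.
move=> dg; apply: (eq_trans (derive_comp v (differentiable_hd u) dg)).
exact: (congr1 (fun z => 'D_z g (hd u)) (derive_hd u v)).
Qed.

Lemma derive_comp_tl (W : normedModType R) (g : 'rV[R]_n -> W) (u v : 'rV[R]_(1 + n)) :
  differentiable g (tl u) -> 'D_v (fun y => g (tl y)) u = 'D_(tl v) g (tl u).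
Proof.
move=> dg; apply: (eq_trans (derive_comp v (differentiable_tl u) dg)).
exact: (congr1 (fun z => 'D_z g (tl u)) (derive_tl u v)).
Qed.

Lemma derive_cons (g : V -> R) (K : V -> 'rV[R]_n) x v :
  differentiable g x -> differentiable K x ->
  'D_v (fun y => cons_rv (g y) (K y)) x = cons_rv ('D_v g x) ('D_v K x).
Proof.
move=> dg dK.
pose F y := cons_rv (g y) (K y).
have dF : differentiable F x.
  apply: differentiable_mx => i j; rewrite (ord1 i) /F /cons_rv.
  case: (splitP j) => k jk.
    have -> : j = lshift n k by exact/val_inj.
    have -> : (fun y => row_mx (g y)%:M (K y) ord0 (lshift n k)) = g.
      by apply/funext => y; rewrite row_mxEl mxE (ord1 k) mulr1n.
    exact: dg.
  have -> : j = rshift 1 k by exact/val_inj.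
  have -> : (fun y => row_mx (g y)%:M (K y) ord0 (rshift 1 k)) =
      (fun y => K y ord0 k) by apply/funext => y; rewrite row_mxEr.
  exact: (differentiable_comp dK (differentiable_coord _ _ _)).
have hE : hd ('D_v F x) = 'D_v g x.
  apply: (eq_trans (esym (derive_hd (F x) _))).
  apply: (eq_trans (esym (derive_comp v dF (differentiable_hd _)))).
  by apply: (congr1 (fun G => 'D_v G x)); apply/funext => y; rewrite /= hd_cons.
have tE : tl ('D_v F x) = 'D_v K x.
  apply: (eq_trans (esym (derive_tl (F x) _))).
  apply: (eq_trans (esym (derive_comp v dF (differentiable_tl _)))).
  by apply: (congr1 (fun G => 'D_v G x)); apply/funext => y; rewrite /= tl_cons.
by rewrite -[LHS]cons_hd_tl hE tE.
Qed.

Lemma continuous_hd : continuous (@hd R n).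
Proof. by move=> u; exact/differentiable_continuous/differentiable_hd. Qed.

Lemma continuous_tl : continuous (@tl R n).
Proof. by move=> u; exact/differentiable_continuous/differentiable_tl. Qed.

Lemma open_hd_tl (A : set R) (B : set 'rV[R]_n) : open A -> open B ->
  open [set u : 'rV[R]_(1 + n) | A (hd u) /\ B (tl u)].
Proof.
move=> oA oB; apply: openI.
  by apply: open_comp oA => u _; exact: continuous_hd.
by apply: open_comp oB => u _; exact: continuous_tl.
Qed.

End HeadTail.

Lemma cons0_sumZ (R : realType) n k (b : 'I_k -> R) (x : 'I_k -> 'rV[R]_n) :
  cons_rv 0 (\sum_i b i *: x i) = \sum_i b i *: cons_rv 0 (x i).
Proof.
rewrite (big_morph (cons_rv 0) (id1 := 0) (op1 := +%R)).
- apply: eq_bigr => i _.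
  by rewrite /cons_rv scale_row_mx scale_scalar_mx mulr0.
- by move=> u v; rewrite /cons_rv add_row_mx raddf0 addr0.
- by rewrite /cons_rv raddf0 row_mx0.
Qed.

(** * Open domains of charts *)

Lemma open_preimage_in (T U : topologicalType) (A : set T) (g : T -> U) (B : set U) :
  open A -> (forall x, A x -> {for x, continuous g}) -> open B ->
  open [set x | A x /\ B (g x)].
Proof.
move=> oA cg oB; rewrite openE => x [Ax Bgx].
by apply: filterI; [exact: near_open|apply: (cg _ Ax); exact: near_open].
Qed.

Lemma continuous_pair (T U V : topologicalType) (g : T -> U) (h : T -> V) x :
  {for x, continuous g} -> {for x, continuous h} ->
  {for x, continuous (fun y => (g y, h y))}.
Proof. by move=> cg ch; exact: (cvg_pair cg ch). Qed.

Section ChartFacts.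
Variables (R : realType) (M : topologicalType) (m : nat) (c : chart R M m).
Hypothesis chart_c : is_chart c.

Lemma cmap_cod x : cdom c x -> cod c (cmap c x).
Proof. by move=> cx; exists x. Qed.

Lemma cinv_dom u : cod c u -> cdom c (cinv c u).
Proof. by case: chart_c => _ _ cK _ _ [x cx <-]; rewrite cK. Qed.

Lemma cinvK u : cod c u -> cmap c (cinv c u) = u.
Proof. by case: chart_c => _ _ cK _ _ [x cx <-]; rewrite cK. Qed.

Lemma cmapK x : cdom c x -> cinv c (cmap c x) = x.
Proof. by case: chart_c => _ _ cK _ _ /cK. Qed.

End ChartFacts.

(** * The twisted decomposition in charts *)

Section Decomposition.
Variables (R : realType) (m : nat) (F : riemannian R (1 + m)) (x0 : F).
Variable D : twisted_decomposition x0.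
Variables (c : chart R F (1 + m)) (d : chart R (tdS D) m).
Hypotheses (atlas_c : atlas c) (atlas_d : atlas d).

Definition theta_loc (v : 'rV[R]_(1 + m)) : 'rV[R]_(1 + m) :=
  let p := tdTheta D (cinv c v) in cons_rv p.1 (cmap d p.2).

Definition theta_loc_dom : set 'rV[R]_(1 + m) :=
  [set v | [/\ cod c v, tdV D (cinv c v) & cdom d (tdTheta D (cinv c v)).2]].

Lemma chart_domain_open : open [set v | cod c v /\ tdV D (cinv c v)].
Proof.
have [_ oc _ _ ci] := atlas_chart atlas_c.
by apply: open_preimage_in; [exact: oc|exact: ci|exact: tdV_open].
Qed.

Lemma psi_dom_open : open (@tdPsi_dom R m F x0 D d c).
Proof.
have [oJ _ _] := tdJ_interval D.
have [_ od _ _ di] := atlas_chart atlas_d.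
have [occ _ _ _ _] := atlas_chart atlas_c.
pose g (u : 'rV[R]_(1 + m)) := tdPsi D (hd u, cinv d (tl u)).
have -> : @tdPsi_dom R m F x0 D d c =
    [set u | [set u | tdJ D (hd u) /\ cod d (tl u)] u /\ cdom c (g u)].
  apply/funext => u; apply/propext; split; first by case.
  by case=> -[].
apply: open_preimage_in => //; first exact: open_hd_tl.
move=> u [/= Ju du].
apply: (@continuous_comp _ _ _ (fun u : 'rV[R]_(1 + m) => (hd u, cinv d (tl u))) (tdPsi D)).
  apply: continuous_pair; first exact: continuous_hd.
  apply: (@continuous_comp _ _ _ (@tl R m) (cinv d)); first exact: continuous_tl.
  exact: di.
exact: tdPsi_cont.
Qed.

Lemma theta_loc_dom_open : open theta_loc_dom.
Proof.
have [_ oc _ _ ci] := atlas_chart atlas_c.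
have [od _ _ _ _] := atlas_chart atlas_d.
have -> : theta_loc_dom = [set v | [set v | cod c v /\ tdV D (cinv c v)] v /\
    cdom d (tdTheta D (cinv c v)).2].
  apply/funext => u; apply/propext; split; first by case.
  by case=> -[].
apply: open_preimage_in => //; first exact: chart_domain_open.
move=> v [/= cv Vv].
apply: (@continuous_comp _ _ _ (fun v => tdTheta D (cinv c v)) snd); last exact: cvg_snd.
apply: (@continuous_comp _ _ _ (cinv c) (tdTheta D)); first exact: ci.
exact: tdTheta_cont.
Qed.

Lemma tdThetaK x : tdV D x -> tdPsi D (tdTheta D x) = x /\ tdJ D (tdTheta D x).1.
Proof. by case=> p Jp <-; rewrite tdPsiK. Qed.

Lemma theta_loc_in v : theta_loc_dom v -> tdPsi_dom d c (theta_loc v).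
Proof.
case=> cv Vv dv; have [E J] := tdThetaK Vv.
rewrite /theta_loc; split; rewrite ?hd_cons ?tl_cons//.
  exact: cmap_cod.
rewrite (cmapK (atlas_chart atlas_d) dv) -surjective_pairing E.
exact: (cinv_dom (atlas_chart atlas_c)).
Qed.

Lemma theta_locK v : theta_loc_dom v -> tdPsi_loc d c (theta_loc v) = v.
Proof.
case=> cv Vv dv; have [E J] := tdThetaK Vv.
rewrite /theta_loc /tdPsi_loc hd_cons tl_cons (cmapK (atlas_chart atlas_d) dv).
by rewrite -surjective_pairing E (cinvK (atlas_chart atlas_c)).
Qed.

Lemma psi_in q : tdPsi_dom d c q -> theta_loc_dom (tdPsi_loc d c q).
Proof.
case=> Jq dq cq; rewrite /tdPsi_loc; split.
- exact: cmap_cod.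
- by rewrite (cmapK (atlas_chart atlas_c) cq); exists (hd q, cinv d (tl q)).
- by rewrite (cmapK (atlas_chart atlas_c) cq) tdPsiK//=; exact: (cinv_dom (atlas_chart atlas_d)).
Qed.

Lemma psiK q : tdPsi_dom d c q -> theta_loc (tdPsi_loc d c q) = q.
Proof.
case=> Jq dq cq; rewrite /theta_loc /tdPsi_loc (cmapK (atlas_chart atlas_c) cq) tdPsiK//=.
by rewrite (cinvK (atlas_chart atlas_d) dq) cons_hd_tl.
Qed.

Lemma differentiable_psi q : tdPsi_dom d c q -> differentiable (tdPsi_loc d c) q.
Proof. exact: smooth_map_differentiable (tdPsi_smooth atlas_d atlas_c). Qed.

Lemma differentiable_theta_loc v : theta_loc_dom v -> differentiable theta_loc v.
Proof. exact: smooth_map_differentiable (tdTheta_smooth atlas_d atlas_c). Qed.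

(** Chain rule for the identity [psi o theta]: each tangent vector of F is the
    image of a vector of J x S. *)
Lemma derive_psi_theta v Y : theta_loc_dom v ->
  'D_('D_Y theta_loc v) (tdPsi_loc d c) (theta_loc v) = Y.
Proof.
move=> vin.
have dpsi := differentiable_psi (theta_loc_in vin).
apply: (eq_trans (esym (derive_comp Y (differentiable_theta_loc vin) dpsi))).
apply: (eq_trans (@near_eq_derive _ _ _ _ id _ _ _)); last exact: derive_id.
by apply: filterS (near_open theta_loc_dom_open vin) => w; exact: theta_locK.
Qed.

Lemma psi_isometry q V W : tdPsi_dom d c q ->
  ip (gram c (tdPsi_loc d c q)) ('D_V (tdPsi_loc d c) q) ('D_W (tdPsi_loc d c) q) =
  hd V * hd W + tdmu D (hd q) (cinv d (tl q)) ^+ 2 * ip (gram d (tl q)) (tl V) (tl W).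
Proof.
move=> hq; have dpsi := differentiable_psi hq.
apply: (eq_trans _ (td_isometry V W atlas_d atlas_c hq)).
have e1 := deriveE V dpsi; have e2 := deriveE W dpsi.
apply: (eq_trans (congr1 (fun z => ip _ z _) e1)).
exact: (congr1 (fun z => ip _ _ z) e2).
Qed.

End Decomposition.

(** * The dual hypersurface and its null field *)

Section Dual.
Variables (R : realType) (m : nat) (I : set R) (f : R -> R).
Hypotheses (I_interval : open_interval I) (f_smooth : smooth_on I f)
  (f_gt0 : forall t, I t -> 0 < f t).
Variables (F : riemannian R (1 + m)) (t0 : R) (x0 : F).
Hypothesis It0 : I t0.
Variable D : twisted_decomposition x0.

Definition conformal_time : R -> R := oriented_integral (fun r => (f r)^-1) t0.

Lemma open_I : open I. Proof. by case: I_interval. Qed.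

Lemma f_neq0 t : I t -> f t != 0.
Proof. by move=> /f_gt0 /lt0r_neq0. Qed.

Lemma smooth_finv : smooth_on I (fun t => (f t)^-1).
Proof. by apply: smoothV => //; [exact: open_I|exact: f_neq0]. Qed.

Lemma is_derive_conformal_time t : I t -> is_derive t 1 conformal_time (f t)^-1.
Proof.
move=> It; apply: (is_derive_oriented_integral I_interval) => // r Ir.
exact/differentiable_continuous/(smooth_differentiable smooth_finv).
Qed.

Lemma smooth_conformal_time : smooth_on I conformal_time.
Proof.
apply: smooth_primitive smooth_finv; first exact: open_I.
exact: is_derive_conformal_time.
Qed.

Lemma derive_conformal_time t v : I t -> 'D_v conformal_time t = v / f t.
Proof.
move=> It; apply: (eq_trans (derive_real _ (smooth_differentiable smooth_conformal_time It))).
exact: (congr1 (fun z => v * z) (@derive_val _ _ _ _ _ _ _ (is_derive_conformal_time It))).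
Qed.

Lemma ip_grw (c : chart R F (1 + m)) u v w :
  ip (grw_metric f c u) v w =
  - (hd v * hd w) + f (hd u) ^+ 2 * ip (gram c (tl u)) (tl v) (tl w).
Proof.
rewrite -{1}[v]cons_hd_tl -{1}[w]cons_hd_tl /grw_metric /cons_rv {1}/ip.
rewrite tr_row_mx mul_row_block mul_row_col !mulmx0 addr0 add0r.
rewrite mxE; congr (_ + _); last by rewrite -scalemxAr -scalemxAl mxE.
by rewrite tr_scalar_mx -!scalar_mxM mxE mulr1n mulrN1 mulNr.
Qed.

(** The part of a chart covered by the twisted decomposition; it is the domain on
    which the smooth extensions of the data along the dual are defined. *)
Definition tube (c : chart R F (1 + m)) : set 'rV[R]_(1 + (1 + m)) :=
  [set u | I (hd u) /\ (cod c (tl u) /\ tdV D (cinv c (tl u)))].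

Definition height (c : chart R F (1 + m)) (u : 'rV[R]_(1 + (1 + m))) : R :=
  (tdTheta D (cinv c (tl u))).1 + conformal_time (hd u).

(** The field - f^-1 d_t + f^-2 d_s.  The vector d_s of F is the velocity of
    the curve s |-> Psi (s, z), which makes the formula free of any chart of
    S. *)
Definition dual_xi (c : chart R F (1 + m)) (u : 'rV[R]_(1 + (1 + m))) :
    'rV[R]_(1 + (1 + m)) :=
  let p := tdTheta D (cinv c (tl u)) in
  cons_rv (- (f (hd u))^-1)
    ((f (hd u))^-1 ^+ 2 *: 'D_1 (fun s => cmap c (tdPsi D (s, p.2))) p.1).

(** The function rho with B = rho g on the dual.  It lives on I x F, because a
    single function has to serve in all charts. *)
Definition dual_rho (q : R * F) : R :=
  let p := tdTheta D q.2 in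
  (derive1 f q.1 - derive1 (fun r => tdmu D r p.2) p.1 / tdmu D p.1 p.2) / f q.1 ^+ 2.

Section Chart.
Variables (c : chart R F (1 + m)).
Hypotheses (atlas_c : atlas c).

Lemma tube_open : open (tube c).
Proof. exact: (open_hd_tl open_I (chart_domain_open (D := D) atlas_c)). Qed.

Lemma smooth_grw i j :
  smooth_on [set u : 'rV[R]_(1 + (1 + m)) | I (hd u) /\ cod c (tl u)]
    (fun u => grw_metric f c u i j).
Proof.
have oU : open [set u : 'rV[R]_(1 + (1 + m)) | I (hd u) /\ cod c (tl u)].
  by apply: open_hd_tl open_I _; case: (atlas_chart atlas_c).
rewrite /grw_metric; case: (splitP i) => i' ii; case: (splitP j) => j' jj.
- have -> : i = lshift _ i' by exact/val_inj.
  have -> : j = lshift _ j' by exact/val_inj.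
  apply: smooth_ext (smooth_cst _ ((-1)%:M i' j')) => // u _.
  by rewrite block_mxEul.
- have -> : i = lshift _ i' by exact/val_inj.
  have -> : j = rshift 1 j' by exact/val_inj.
  by apply: smooth_ext (smooth_cst _ 0) => // u _; rewrite block_mxEur mxE.
- have -> : i = rshift 1 i' by exact/val_inj.
  have -> : j = lshift _ j' by exact/val_inj.
  by apply: smooth_ext (smooth_cst _ 0) => // u _; rewrite block_mxEdl mxE.
have -> : i = rshift 1 i' by exact/val_inj.
have -> : j = rshift 1 j' by exact/val_inj.
have sf : smooth_on [set u : 'rV[R]_(1 + (1 + m)) | I (hd u) /\ cod c (tl u)]
    (fun u => f (hd u)).
  by apply: smooth_comp_real f_smooth _ => //; [exact: smooth_hd|move=> u []].
have sg : smooth_on [set u : 'rV[R]_(1 + (1 + m)) | I (hd u) /\ cod c (tl u)]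
    (fun u => gram c (tl u) i' j').
  apply: (smooth_comp_map (g := fun v => gram c v i' j')) (gram_smooth atlas_c i' j') _ => //.
    exact: smooth_tl.
  by move=> u [].
apply: smooth_ext (smoothM oU (smoothM oU sf sf) sg) => // u _.
by rewrite block_mxEdr mxE.
Qed.

Lemma differentiable_grw u : I (hd u) -> cod c (tl u) ->
  differentiable (grw_metric f c) u.
Proof.
move=> Iu cu; apply: differentiable_mx => i j.
exact: (smooth_differentiable (smooth_grw i j)).
Qed.

Lemma grw_sym u : cod c (tl u) -> (grw_metric f c u)^T = grw_metric f c u.
Proof.
move=> cu; rewrite /grw_metric tr_block_mx !trmx0 tr_scalar_mx linearZ /=.
by rewrite gram_sym.
Qed.

Lemma grw_unit u : I (hd u) -> cod c (tl u) -> grw_metric f c u \in unitmx.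
Proof.
move=> Iu cu; apply: nondegenerate_unitmx => v v0.
have ip0 w : ip (grw_metric f c u) v w = 0 by rewrite /ip v0 mul0mx mxE.
have hv : hd v = 0.
  have := ip0 (cons_rv 1 0); rewrite ip_grw hd_cons tl_cons ip0r mulr0 addr0 mulr1.
  by move/eqP; rewrite oppr_eq0 => /eqP.
have tv : tl v = 0.
  apply/eqP; apply: contraT => tv0.
  have := gram_pos atlas_c cu tv0.
  have := ip0 v; rewrite ip_grw hv mulr0 oppr0 add0r => /eqP.
  by rewrite mulf_eq0 expf_eq0 /= (negbTE (f_neq0 Iu)) /= => /eqP ->; rewrite ltxx.
by rewrite -[v]cons_hd_tl hv tv /cons_rv raddf0 row_mx0.
Qed.

Lemma in_chart_dualP u : in_chart I c (dual_set I f t0 D) u <->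
  tube c u /\ height c u = 0.
Proof.
split.
  case=> Iu cu [t [s [z [It Js sE [tE zE]]]]].
  split; first by split=> //; split=> //; rewrite zE; exists (s, z).
  by rewrite /height zE tdPsiK//= tE sE oriented_integralN addNr.
case=> -[Iu [cu Vu]] h0; split=> //.
have [E J] := tdThetaK Vu.
exists (hd u), (tdTheta D (cinv c (tl u))).1, (tdTheta D (cinv c (tl u))).2.
split=> //; last by rewrite -surjective_pairing E.
by apply/eqP; rewrite oriented_integralN -addr_eq0; apply/eqP.
Qed.

Section SubChart.
Variable (d : chart R (tdS D) m).
Hypothesis (atlas_d : atlas d).

(** Every point of [tube] lies in [subtube] for some chart [d] of S; local claims
    are proved there, in the coordinates of [d]. *)
Definition subtube : set 'rV[R]_(1 + (1 + m)) :=
  [set u | I (hd u) /\ theta_loc_dom c d (tl u)].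

Definition straight_dom : set 'rV[R]_(1 + (1 + m)) :=
  [set q | I (hd q) /\ tdPsi_dom d c (tl q)].

(** From product coordinates (t, s, z) to the chart [c]. *)
Definition straight (q : 'rV[R]_(1 + (1 + m))) : 'rV[R]_(1 + (1 + m)) :=
  cons_rv (hd q) (tdPsi_loc d c (tl q)).

Definition unstraight (u : 'rV[R]_(1 + (1 + m))) : 'rV[R]_(1 + (1 + m)) :=
  cons_rv (hd u) (theta_loc c d (tl u)).

Lemma subtube_open : open subtube.
Proof. exact: (open_hd_tl open_I (theta_loc_dom_open atlas_c atlas_d)). Qed.

Lemma straight_dom_open : open straight_dom.
Proof. exact: (open_hd_tl open_I (psi_dom_open atlas_c atlas_d)). Qed.

Lemma subtube_tube : subtube `<=` tube c.
Proof. by move=> u [Iu []]. Qed.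

Lemma unstraight_in u : subtube u -> straight_dom (unstraight u).
Proof.
by move=> [Iu tu]; rewrite /straight_dom /unstraight /= hd_cons tl_cons; split=> //; exact: theta_loc_in.
Qed.

Lemma straight_in q : straight_dom q -> subtube (straight q).
Proof.
by move=> [Iu tu]; rewrite /subtube /straight /= hd_cons tl_cons; split=> //; exact: psi_in.
Qed.

Lemma unstraightK u : subtube u -> straight (unstraight u) = u.
Proof.
move=> [Iu tu]; rewrite /straight /unstraight hd_cons tl_cons theta_locK//.
exact: cons_hd_tl.
Qed.

Lemma smooth_straight : smooth_map straight_dom straight.
Proof.
apply: smooth_cons; [exact: straight_dom_open|exact: smooth_hd|move=> j].
apply: (smooth_comp_map (g := fun v => tdPsi_loc d c v ord0 j))
  (tdPsi_smooth atlas_d atlas_c j) _; first exact: straight_dom_open.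
  exact: smooth_tl.
by move=> u [].
Qed.

Lemma derive_straight q V : straight_dom q ->
  'D_V straight q = cons_rv (hd V) ('D_(tl V) (tdPsi_loc d c) (tl q)).
Proof.
move=> [Iq pq]; have dpsi := differentiable_psi atlas_c atlas_d pq.
apply: (eq_trans (derive_cons V (differentiable_hd q)
  (differentiable_comp (differentiable_tl q) dpsi))).
exact: (f_equal2 (fun a b => cons_rv a b) (derive_hd q V) (derive_comp_tl V dpsi)).
Qed.

(** [straight] is the identity in t, and the isometry Psi in (s, z). *)
Lemma straight_metric q V W : straight_dom q ->
  ip (grw_metric f c (straight q)) ('D_V straight q) ('D_W straight q) =
  - (hd V * hd W) + f (hd q) ^+ 2 * (hd (tl V) * hd (tl W) +
    tdmu D (hd (tl q)) (cinv d (tl (tl q))) ^+ 2 *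
    ip (gram d (tl (tl q))) (tl (tl V)) (tl (tl W))).
Proof.
move=> hq; have [Iq pq] := hq.
apply: (eq_trans (congr1 (fun z => ip _ z _) (derive_straight V hq))).
apply: (eq_trans (congr1 (fun z => ip _ _ z) (derive_straight W hq))).
have E al be x y : ip (grw_metric f c (straight q)) (cons_rv al x) (cons_rv be y) =
    - (al * be) + f (hd q) ^+ 2 * ip (gram c (tdPsi_loc d c (tl q))) x y.
  by rewrite ip_grw !hd_cons !tl_cons.
apply: (eq_trans (E _ _ _ _)).
exact: (congr1 (fun z => _ + _ * z) (psi_isometry atlas_c atlas_d (tl V) (tl W) pq)).
Qed.

Lemma derive_straight_unstraight u Y : subtube u ->
  'D_(cons_rv (hd Y) ('D_(tl Y) (theta_loc c d) (tl u))) straight (unstraight u) = Y.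
Proof.
move=> hu; have [Iu tu] := hu.
apply: (eq_trans (derive_straight _ (unstraight_in hu))).
rewrite /unstraight !hd_cons !tl_cons derive_psi_theta//.
exact: cons_hd_tl.
Qed.

Lemma heightE u : subtube u -> height c u = hd (theta_loc c d (tl u)) + conformal_time (hd u).
Proof. by move=> _; rewrite /height /theta_loc hd_cons. Qed.

Lemma smooth_height_sub : smooth_on subtube (height c).
Proof.
have oU := subtube_open.
have s1 : smooth_on subtube (fun u => hd (theta_loc c d (tl u))).
  have s := tdTheta_smooth atlas_d atlas_c (lshift m ord0).
  apply: (@smooth_ext _ _ _ _ (fun u => theta_loc c d (tl u) ord0 (lshift m ord0))) => //.
    by move=> u _; rewrite /hd mxE.
  apply: (smooth_comp_map (g := fun v => theta_loc c d v ord0 (lshift m ord0))) s _ => //.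
    exact: smooth_tl.
  by move=> u [].
have s2 : smooth_on subtube (fun u => conformal_time (hd u)).
  apply: smooth_comp_real smooth_conformal_time _ => //; first exact: smooth_hd.
  by move=> u [].
apply: smooth_ext (smoothD oU s1 s2) => // u; exact: heightE.
Qed.

Lemma derive_height u Y : subtube u ->
  'D_Y (height c) u = hd ('D_(tl Y) (theta_loc c d) (tl u)) + hd Y / f (hd u).
Proof.
move=> hu; have [Iu tu] := hu.
have dth := differentiable_theta_loc atlas_c atlas_d tu.
pose g1 (w : 'rV[R]_(1 + (1 + m))) : R := hd (theta_loc c d (tl w)).
pose g2 (w : 'rV[R]_(1 + (1 + m))) : R := conformal_time (hd w).
have dP := smooth_differentiable smooth_conformal_time Iu.
have D1 : 'D_Y g1 u = hd ('D_(tl Y) (theta_loc c d) (tl u)).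
  have dth' : differentiable (fun w : 'rV[R]_(1 + (1 + m)) => theta_loc c d (tl w)) u.
    exact: (differentiable_comp (differentiable_tl u) dth).
  apply: (eq_trans (derive_comp Y dth' (differentiable_hd _))).
  apply: (eq_trans (derive_hd _ _)).
  exact: (congr1 (@hd R m) (derive_comp_tl Y dth)).
have D2 : 'D_Y g2 u = hd Y / f (hd u).
  apply: (eq_trans (derive_comp_hd Y dP)); exact: derive_conformal_time.
have dg1 : derivable g1 u Y.
  apply: diff_derivable; apply: (differentiable_comp _ (differentiable_hd _)).
  exact: (differentiable_comp (differentiable_tl u) dth).
have dg2 : derivable g2 u Y.
  by apply: diff_derivable; exact: (differentiable_comp (differentiable_hd u) dP).
apply: (eq_trans _ (f_equal2 +%R D1 D2)).
apply: (eq_trans _ (deriveD dg1 dg2)).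
apply: near_eq_derive; apply: filterS (near_open subtube_open hu) => w.
exact: heightE.
Qed.

Lemma derive_psi_first q : tdPsi_dom d c q ->
  'D_1 (fun s => cmap c (tdPsi D (s, cinv d (tl q)))) (hd q) =
  'D_(cons_rv 1 0) (tdPsi_loc d c) q.
Proof.
move=> pq.
apply: (eq_trans (derive_along _ _ _)).
apply: (eq_trans _ (esym (derive_along _ _ _))).
have E : (fun h : R => cmap c (tdPsi D (h *: 1 + hd q, cinv d (tl q)))) =
    (fun h : R => tdPsi_loc d c (h *: cons_rv 1 0 + q)).
  apply/funext => h.
  by rewrite /tdPsi_loc hdD hdZ tlD tlZ hd_cons tl_cons scaler0 add0r.
exact: (congr1 (fun g : R -> 'rV[R]_(1 + m) => 'D_1 g (0 : R)) E).
Qed.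

Lemma dual_xiE u : subtube u ->
  dual_xi c u = cons_rv (- (f (hd u))^-1)
   ((f (hd u))^-1 ^+ 2 *: 'D_(cons_rv 1 0) (tdPsi_loc d c) (theta_loc c d (tl u))).
Proof.
move=> [Iu tu].
have E := derive_psi_first (theta_loc_in atlas_c atlas_d tu).
have [_ _ dv] := tu.
apply: (congr1 (fun z => cons_rv _ (_ *: z))).
apply: (eq_trans _ E).
by rewrite /theta_loc hd_cons tl_cons (cmapK (atlas_chart atlas_d) dv).
Qed.

Lemma smooth_dual_xi_sub : smooth_map subtube (dual_xi c).
Proof.
have oU := subtube_open.
have sfi : smooth_on subtube (fun u => (f (hd u))^-1).
  apply: smooth_comp_real smooth_finv _ => //; first exact: smooth_hd.
  by move=> u [].
have sth : smooth_map subtube (fun u => theta_loc c d (tl u)).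
  move=> j; apply: (smooth_comp_map (g := fun v => theta_loc c d v ord0 j))
    (tdTheta_smooth atlas_d atlas_c j) _ => //; first exact: smooth_tl.
  by move=> u [].
have s : smooth_map subtube (fun u => cons_rv (- (f (hd u))^-1)
   ((f (hd u))^-1 ^+ 2 *: 'D_(cons_rv 1 0) (tdPsi_loc d c) (theta_loc c d (tl u)))).
  apply: smooth_cons => //; first exact: smoothN.
  move=> j.
  have spsi := smooth_map_derive (cons_rv 1 0) (psi_dom_open atlas_c atlas_d) (tdPsi_smooth atlas_d atlas_c).
  have sj : smooth_on subtube (fun u =>
      ('D_(cons_rv 1 0) (tdPsi_loc d c) (theta_loc c d (tl u))) ord0 j).
    apply: (smooth_comp_map (g := fun q => ('D_(cons_rv 1 0) (tdPsi_loc d c) q) ord0 j))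
      (spsi j) _ => //.
    by move=> u [_ tu]; exact: theta_loc_in.
  apply: smooth_ext (smoothM oU (smoothM oU sfi sfi) sj) => // u _.
  by rewrite mxE.
move=> j; apply: (smooth_ext oU _ (s j)) => u hu.
exact: (congr1 (fun M : 'rV[R]_(1 + (1 + m)) => M ord0 j) (dual_xiE hu)).
Qed.

(** Write [Y] as the image of a vector W of the product.  The metric of the
    product pairs - f^-1 d_t + f^-2 d_s with W into dt(W) / f + ds(W), the
    differential of s + P(t). *)
Lemma dual_xi_gradient_sub u Y : subtube u ->
  ip (grw_metric f c u) (dual_xi c u) Y = 'D_Y (height c) u.
Proof.
move=> hu; have [Iu tu] := hu.
apply: (eq_trans _ (esym (derive_height Y hu))).
apply: (eq_trans (congr1 (fun z => ip _ z _) (dual_xiE hu))).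
rewrite ip_grw hd_cons tl_cons ipZl.
have E := psi_isometry atlas_c atlas_d (cons_rv 1 0) ('D_(tl Y) (theta_loc c d) (tl u))
  (theta_loc_in atlas_c atlas_d tu).
rewrite hd_cons tl_cons ip0l mulr0 addr0 mul1r theta_locK// in E.
have E' : ip (gram c (tl u)) ('D_(cons_rv 1 0) (tdPsi_loc d c) (theta_loc c d (tl u))) (tl Y)
    = hd ('D_(tl Y) (theta_loc c d) (tl u)).
  apply: (eq_trans _ E); apply: (congr1 (fun z => ip _ _ z)).
  exact/esym/derive_psi_theta.
apply: (eq_trans (congr1 (fun z => _ + _ * (_ * z)) E')).
move: (hd ('D_(tl Y) (theta_loc c d) (tl u))) => z.
by field; exact: f_neq0.
Qed.

Lemma vertical_metric q v w : straight_dom q ->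
  ip (grw_metric f c (straight q)) ('D_(cons_rv 0 (cons_rv 0 v)) straight q)
    ('D_(cons_rv 0 (cons_rv 0 w)) straight q) =
  f (hd q) ^+ 2 * tdmu D (hd (tl q)) (cinv d (tl (tl q))) ^+ 2 *
  ip (gram d (tl (tl q))) v w.
Proof.
move=> hq; apply: (eq_trans (straight_metric _ _ hq)).
by rewrite !tl_cons !hd_cons mul0r oppr0 !add0r mulrA.
Qed.

Lemma height_straight q : straight_dom q ->
  height c (straight q) = hd (tl q) + conformal_time (hd q).
Proof.
move=> hq; have [Iq pq] := hq.
rewrite (heightE (straight_in hq)) /straight hd_cons tl_cons.
by rewrite (psiK atlas_c atlas_d pq).
Qed.

(** In product coordinates the null field depends on [t] only, hence is constant
    on the slices of constant [t]. *)
Lemma dual_xi_straight q t : straight_dom q -> hd q = t ->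
  dual_xi c (straight q) =
  'D_(cons_rv (- (f t)^-1) (cons_rv ((f t)^-1 ^+ 2) 0)) straight q.
Proof.
move=> hq <-; have [Iq pq] := hq.
apply: (eq_trans (dual_xiE (straight_in hq))).
apply: (eq_trans _ (esym (derive_straight _ hq))).
rewrite /straight !hd_cons !tl_cons (psiK atlas_c atlas_d pq).
apply: (congr1 (fun z => cons_rv _ z)).
apply: (eq_trans (esym (deriveZdir _ _ (differentiable_psi atlas_c atlas_d pq)))).
apply: (congr1 (fun z => 'D_z (tdPsi_loc d c) (tl q))).
by rewrite /cons_rv scale_row_mx scaler0 scale_scalar_mx mulr1.
Qed.

Lemma derive_mu q : tdJ D (hd q) -> cod d (tl q) ->
  'D_(cons_rv 1 0) (fun q : 'rV[R]_(1 + m) => tdmu D (hd q) (cinv d (tl q))) q =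
  derive1 (fun r => tdmu D r (cinv d (tl q))) (hd q).
Proof.
move=> Jq dq.
apply: (eq_trans (derive_along _ _ _)).
apply: (eq_trans _ (esym (derive1E _ _))).
apply: (eq_trans _ (esym (derive_along _ _ _))).
have E : (fun h : R => tdmu D (hd (h *: cons_rv 1 0 + q)) (cinv d (tl (h *: cons_rv 1 0 + q)))) =
    (fun h : R => tdmu D (h *: 1 + hd q) (cinv d (tl q))).
  by apply/funext => h; rewrite hdD hdZ tlD tlZ hd_cons tl_cons scaler0 add0r.
exact: (congr1 (fun g : R -> R => 'D_1 g (0 : R)) E).
Qed.

(** On a slice of constant [t] the null field is the image of the constant
    vector [a], so the Lie derivative of the metric reduces to the derivative
    along [a] of f^2 mu^2 g_S(v, w): f changes at the rate - f' / f and mu at the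
    rate mu_s / f^2, while g_S(v, w) does not change. *)
Lemma dual_fundamental_form p v w : straight_dom p ->
  null_fundamental_form (grw_metric f c) (dual_xi c) (straight p)
    ('D_(cons_rv 0 (cons_rv 0 v)) straight p)
    ('D_(cons_rv 0 (cons_rv 0 w)) straight p) =
  dual_rho (grw_point c (straight p)) *
  ip (grw_metric f c (straight p)) ('D_(cons_rv 0 (cons_rv 0 v)) straight p)
    ('D_(cons_rv 0 (cons_rv 0 w)) straight p).
Proof.
move=> hp; have [Ip pp] := hp; have [Jp dp _] := pp.
set V : 'rV[R]_(1 + (1 + m)) := cons_rv 0 (cons_rv 0 v).
set W : 'rV[R]_(1 + (1 + m)) := cons_rv 0 (cons_rv 0 w).
pose t := hd p; pose s := hd (tl p); pose z := cinv d (tl (tl p)).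
pose a : 'rV[R]_(1 + (1 + m)) := cons_rv (- (f t)^-1) (cons_rv ((f t)^-1 ^+ 2) 0).
have sub := straight_in hp.
have [Iu [cu _]] := subtube_tube sub.
have dG := differentiable_grw Iu cu.
have dxi := smooth_map_differentiable smooth_dual_xi_sub sub.
have sym y : subtube y -> (grw_metric f c y)^T = grw_metric f c y.
  by move=> /subtube_tube[_ [cy _]]; exact: grw_sym.
have G1 := nabla_gradient ('D_V straight p) ('D_W straight p) subtube_open sub
  smooth_height_sub dG dxi (grw_unit Iu cu)
  sym
  (fun y Z hy => dual_xi_gradient_sub Z hy).
have xi_along (X : 'rV[R]_(1 + (1 + m))) : hd X = 0 ->
    \forall h \near (0 : R), dual_xi c (straight (h *: X + p)) = 'D_a straight (h *: X + p).
  move=> X0; apply: filterS (near_line X (near_open straight_dom_open hp)) => h hh.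
  by apply: dual_xi_straight => //; rewrite hdD hdZ X0 mulr0 add0r.
have G2 := lie_derivative_pullback straight_dom_open hp smooth_straight
  smooth_dual_xi_sub sub dG (dual_xi_straight hp (erefl t))
  (xi_along V (hd_cons _ _)) (xi_along W (hd_cons _ _)).
(* The pulled back metric on [V] and [W] is [g1 ^ 2 * g2 ^ 2 * g3]. *)
pose g1 (q : 'rV[R]_(1 + (1 + m))) : R := f (hd q).
pose mu (q : 'rV[R]_(1 + m)) : R := tdmu D (hd q) (cinv d (tl q)).
pose g2 (q : 'rV[R]_(1 + (1 + m))) : R := mu (tl q).
pose g3 (q : 'rV[R]_(1 + (1 + m))) : R := ip (gram d (tl (tl q))) v w.
pose mus := derive1 (fun r => tdmu D r z) s.
have dfp := smooth_differentiable f_smooth Ip.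
have dmu : differentiable mu (tl p) by exact: (smooth_differentiable (tdmu_smooth atlas_d)).
have D1 : is_derive p a g1 (- (f t)^-1 * derive1 f t).
  split; first exact: (diff_derivable (differentiable_comp (differentiable_hd p) dfp)).
  apply: (eq_trans (derive_comp_hd a dfp)).
  apply: (eq_trans (derive_real _ dfp)).
  by rewrite /a hd_cons derive1E.
have D2 : is_derive p a g2 ((f t)^-1 ^+ 2 * mus).
  split; first exact: (diff_derivable (differentiable_comp (differentiable_tl p) dmu)).
  apply: (eq_trans (derive_comp_tl a dmu)).
  have aE : tl a = (f t)^-1 ^+ 2 *: cons_rv 1 0.
    by rewrite /a tl_cons /cons_rv scale_row_mx scaler0 scale_scalar_mx mulr1.
  apply: (eq_trans (congr1 (fun b => 'D_b mu (tl p)) aE)).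
  apply: (eq_trans (deriveZdir _ _ dmu)).
  exact: (congr1 (fun b => _ * b) (derive_mu Jp dp)).
have D3 : is_derive p a g3 0.
  apply: is_derive_const_along => h; rewrite /g3 !tlD !tlZ /a !tl_cons.
  by rewrite scaler0 add0r.
have DE : is_derive p a (fun q => (g1 q * g1 q) * ((g2 q * g2 q) * g3 q))
    (2 * f t * (- (f t)^-1 * derive1 f t) * (mu (tl p) ^+ 2 * g3 p) +
     f t ^+ 2 * (2 * mu (tl p) * ((f t)^-1 ^+ 2 * mus)) * g3 p).
  apply: is_derive_eq (is_deriveM (is_deriveM D1 D1) (is_deriveM (is_deriveM D2 D2) D3)) _.
  have sE (x y : R) : x *: y = x * y by [].
  rewrite !sE !fctE /g1 /g2 -/t; ring.
have E q : straight_dom q -> ip (grw_metric f c (straight q)) ('D_V straight q) ('D_W straight q) =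
    (g1 q * g1 q) * ((g2 q * g2 q) * g3 q).
  move=> hq; apply: (eq_trans (vertical_metric v w hq)).
  by rewrite mulrA -!expr2.
have G3 : 'D_a (fun q => ip (grw_metric f c (straight q)) ('D_V straight q) ('D_W straight q)) p =
    2 * f t * (- (f t)^-1 * derive1 f t) * (mu (tl p) ^+ 2 * g3 p) +
     f t ^+ 2 * (2 * mu (tl p) * ((f t)^-1 ^+ 2 * mus)) * g3 p.
  apply: (eq_trans _ (@derive_val _ _ _ _ _ _ _ DE)).
  apply: near_eq_derive; apply: filterS (near_open straight_dom_open hp) => q; exact: E.
rewrite /null_fundamental_form.
apply: (eq_trans (congr1 -%R (eq_trans G1 (congr1 (fun x => 2^-1 * x) (eq_trans G2 G3))))).
apply: (eq_trans _ (esym (congr1 (fun x => _ * x) (E _ hp)))).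
have -> : dual_rho (grw_point c (straight p)) =
    (derive1 f t - mus / mu (tl p)) / f t ^+ 2.
  rewrite /dual_rho /grw_point /straight /= hd_cons tl_cons.
  by rewrite /tdPsi_loc (cmapK (atlas_chart atlas_c)) ?tdPsiK//; case: pp.
have mu0 : mu (tl p) != 0 by exact/lt0r_neq0/tdmu_gt0.
have ft0 : f t != 0 := f_neq0 Ip.
rewrite /g1 /g2 -/t.
move: (mu (tl p)) mu0 (f t) ft0 (derive1 f t) (g3 p) => x x0' y y0 k n.
by field; rewrite x0' y0.
Qed.

(** The vector is the velocity of the image under [straight] of the curve
    r |-> (t + r a, - P(t + r a), z + r b), which lies in {s + P(t) = 0}. *)
Lemma dual_curve p a b : straight_dom p -> height c (straight p) = 0 ->
  tangent (in_chart I c (dual_set I f t0 D)) (straight p)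
    ('D_(cons_rv a (cons_rv (- (a / f (hd p))) b)) straight p).
Proof.
move=> hp h0; have [Ip pp] := hp.
have sp : hd (tl p) = - conformal_time (hd p).
  by apply/eqP; rewrite -addr_eq0 -(height_straight hp) h0.
pose l (r : R) : R := r *: a + hd p.
pose k (r : R) : R := - conformal_time (l r).
pose n (r : R) : 'rV[R]_m := r *: b + tl (tl p).
pose A0 : set R := l @^-1` I.
have cl : continuous l.
  by move=> r; apply: cvgD; [apply: cvgZr_tmp; exact: cvg_id|exact: cvg_cst].
have oA0 : open A0 by apply: open_comp open_I => r _; exact: cl.
have sl (U : set R) : open U -> smooth_on U l.
  move=> oU; apply: smoothD => //; last exact: smooth_cst.
  apply: smoothM => //; last exact: smooth_cst.
  by apply: smooth_lin => // r; exact: cvg_id.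
have sk : smooth_on A0 k.
  by apply: smoothN => //; apply: smooth_comp_real smooth_conformal_time _ => //; exact: sl.
have sn : smooth_map A0 n.
  move=> j; apply: (@smooth_ext R R _ _ (fun r : R => r * b ord0 j + tl (tl p) ord0 j)) => //.
    by move=> r _; rewrite /n !mxE.
  apply: smoothD => //; last exact: smooth_cst.
  apply: smoothM => //; last exact: smooth_cst.
  by apply: smooth_lin => // r; exact: cvg_id.
pose g r : 'rV[R]_(1 + (1 + m)) := cons_rv (l r) (cons_rv (k r) (n r)).
have sg : smooth_map A0 g.
  apply: smooth_cons => //; first exact: sl.
  exact: smooth_cons.
have g0 : g 0 = p.
  by rewrite /g /k /l /n !scale0r !add0r -sp !cons_hd_tl.
have A00 : A0 0 by rewrite /A0 /= /l scale0r add0r.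
pose A : set R := [set r | A0 r /\ straight_dom (g r)].
have oA : open A.
  apply: (open_preimage_in oA0 _ straight_dom_open) => r Ar.
  exact/differentiable_continuous/(smooth_map_differentiable sg).
exists A, (fun r => straight (g r)); split; first exact: oA.
- by split; [exact: A00|rewrite g0].
- move=> j; apply: (smooth_comp_map (g := fun q => straight q ord0 j))
    (smooth_straight j) _ => //; last by move=> r [].
  by move=> i; apply: smooth_sub (sg i) => r [].
- move=> r [Ar gr]; apply/in_chart_dualP; split; first exact/subtube_tube/straight_in.
  by rewrite height_straight// /g !tl_cons !hd_cons /k addNr.
- split; first by rewrite g0.
  have dg := smooth_map_differentiable sg A00.
  have dst : differentiable straight (g 0).
    by rewrite g0; exact: smooth_map_differentiable smooth_straight hp.
  apply: (eq_trans (@derive_comp R R _ _ g straight 0 1 dg dst)).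
  have Did (e y : R) : 'D_1 (fun r : R => r *: e + y) 0 = e.
    exact: (eq_trans (esym (@derive_along R R R id y e)) (derive_id _ _)).
  have Dk : 'D_1 k 0 = - (a / f (hd p)).
    apply: (eq_trans (esym (@derive_along R R R (fun r => - conformal_time r) (hd p) a))).
    apply: (eq_trans (deriveN _)); last exact: (congr1 -%R (derive_conformal_time a Ip)).
    exact: (diff_derivable (smooth_differentiable smooth_conformal_time Ip)).
  have Dn : 'D_1 n 0 = b.
    apply/rowP => j; apply: (eq_trans (derive_entry _ _ _ (smooth_map_differentiable sn A00))).
    have nj : (fun y => n y ord0 j) = (fun r : R => r *: b ord0 j + tl (tl p) ord0 j).
      by apply/funext => r; rewrite /n !mxE.
    exact: (eq_trans (congr1 (fun G : R -> R => 'D_1 G 0) nj) (Did _ _)).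
  have Dg : 'D_1 g 0 = cons_rv a (cons_rv (- (a / f (hd p))) b).
    have dl := smooth_differentiable (sl _ oA0) A00.
    have dk := smooth_differentiable sk A00.
    have dn := smooth_map_differentiable sn A00.
    have dkn := smooth_map_differentiable (smooth_cons oA0 sk sn) A00.
    apply: (eq_trans (@derive_cons R _ R l _ 0 1 dl dkn)).
    apply: (f_equal2 (fun x y => cons_rv x y)); first exact: Did.
    apply: (eq_trans (@derive_cons R _ R k _ 0 1 dk dn)).
    exact: (f_equal2 (fun x y => cons_rv x y) Dk Dn).
  apply: (eq_trans (congr1 (fun b => 'D_b straight (g 0)) Dg)).
  exact: (congr1 (fun q => 'D__ straight q) g0).
Qed.
End SubChart.

Local Notation dual := (dual_set I f t0 D).

Lemma tube_subtube u : tube c u ->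
  exists d : chart R (tdS D) m, atlas d /\ subtube d u.
Proof.
move=> [Iu [cu Vu]].
by have [d atlas_d dz] := atlas_cover (tdTheta D (cinv c (tl u))).2; exists d.
Qed.

Lemma smooth_height : smooth_on (tube c) (height c).
Proof.
apply: smooth_near => u /tube_subtube[d [atlas_d du]].
exists (subtube d), (height c); split=> //.
- exact: subtube_open.
- exact: smooth_height_sub.
Qed.

Lemma smooth_dual_xi : smooth_map (tube c) (dual_xi c).
Proof.
move=> j; apply: smooth_near => u /tube_subtube[d [atlas_d du]].
exists (subtube d), (fun u => dual_xi c u ord0 j); split=> //.
- exact: subtube_open.
- exact: (smooth_dual_xi_sub atlas_d j).
Qed.

Lemma smooth_dual_rho_sub (d : chart R (tdS D) m) : atlas d ->
  smooth_on (subtube d) (fun u => dual_rho (grw_point c u)).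
Proof.
move=> atlas_d; have oU := subtube_open atlas_d.
pose mu (q : 'rV[R]_(1 + m)) : R := tdmu D (hd q) (cinv d (tl q)).
pose mu_dom : set 'rV[R]_(1 + m) := [set q | tdJ D (hd q) /\ cod d (tl q)].
have omu : open mu_dom.
  have [oJ _ _] := tdJ_interval D; have [_ od _ _ _] := atlas_chart atlas_d.
  exact: open_hd_tl.
have th_mu u : subtube d u -> mu_dom (theta_loc c d (tl u)).
  by move=> [_ tu]; have [] := theta_loc_in atlas_c atlas_d tu.
have sth : smooth_map (subtube d) (fun u => theta_loc c d (tl u)).
  move=> j; apply: (smooth_comp_map (g := fun v => theta_loc c d v ord0 j))
    (tdTheta_smooth atlas_d atlas_c j) _ => //; first exact: smooth_tl.
  by move=> u [].
have sI (g : R -> R) : smooth_on I g -> smooth_on (subtube d) (fun u => g (hd u)).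
  move=> sg; apply: smooth_comp_real sg _ => //; first exact: smooth_hd.
  by move=> u [].
have smu : smooth_on (subtube d) (fun u => mu (theta_loc c d (tl u))).
  exact: (smooth_comp_map oU sth (tdmu_smooth atlas_d) th_mu).
have sdmu : smooth_on (subtube d) (fun u => 'D_(cons_rv 1 0) mu (theta_loc c d (tl u))).
  exact: (smooth_comp_map oU sth (smooth_derive _ (tdmu_smooth atlas_d)) th_mu).
have mu0 u : subtube d u -> mu (theta_loc c d (tl u)) != 0.
  by move=> /th_mu[J _]; exact/lt0r_neq0/tdmu_gt0.
have s := smoothM oU (smoothD oU (sI _ (smooth_derive (1 : R) f_smooth))
  (smoothN oU (smoothM oU sdmu (smoothV oU mu0 smu))))
  (smoothM oU (sI _ smooth_finv) (sI _ smooth_finv)).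
apply: (smooth_ext oU _ s) => u hu.
have [J dz] := th_mu _ hu; have [Iu [_ _ dv]] := hu.
have E := derive_mu J dz.
rewrite /dual_rho /grw_point /= derive1E.
have thE : theta_loc c d (tl u) = cons_rv (tdTheta D (cinv c (tl u))).1
  (cmap d (tdTheta D (cinv c (tl u))).2) by [].
have hE : hd (theta_loc c d (tl u)) = (tdTheta D (cinv c (tl u))).1.
  by rewrite thE hd_cons.
have zE : cinv d (tl (theta_loc c d (tl u))) = (tdTheta D (cinv c (tl u))).2.
  by rewrite thE tl_cons (cmapK (atlas_chart atlas_d)).
rewrite hE zE in E.
have muE : mu (theta_loc c d (tl u)) =
  tdmu D (tdTheta D (cinv c (tl u))).1 (tdTheta D (cinv c (tl u))).2.
  by rewrite /mu hE zE.
rewrite -muE expr2 invfM.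
exact: (congr1 (fun z => (_ - z / _) * _) (esym E)).
Qed.

Lemma smooth_dual_rho : smooth_on (tube c) (fun u => dual_rho (grw_point c u)).
Proof.
apply: smooth_near => u /tube_subtube[d [atlas_d du]].
exists (subtube d), (fun u => dual_rho (grw_point c u)); split=> //.
- exact: subtube_open.
- exact: smooth_dual_rho_sub.
Qed.

(** The height vanishes along every curve in the dual. *)
Lemma tangent_height u v : tangent (in_chart I c dual) u v -> 'D_v (height c) u = 0.
Proof.
case=> A [g [oA A0 sg Lg [g0 Dg]]].
have [tu _] : tube c u /\ height c u = 0 by apply/in_chart_dualP; rewrite -g0; exact: Lg.
have dg := smooth_map_differentiable sg A0.
have dh : differentiable (height c) (g 0).
  by rewrite g0; exact: (smooth_differentiable smooth_height).
have E := @derive_comp R R _ R g (height c) 0 1 dg dh.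
apply: (eq_trans (f_equal2 (fun b x => 'D_b (height c) x) (esym Dg) (esym g0))).
apply: (eq_trans (esym E)).
apply: (eq_trans _ (derive_cst (0 : R) (0 : R) (1 : R))).
apply: near_eq_derive; apply: filterS (near_open oA A0) => r Ar.
by have /in_chart_dualP[_] := Lg _ Ar.
Qed.

Lemma zeta_dual_xi u : tube c u ->
  ip (grw_metric f c u) (grw_zeta f u) (dual_xi c u) = 1.
Proof.
move=> [Iu _]; rewrite ip_grw /grw_zeta /dual_xi !hd_cons !tl_cons ip0l mulr0 addr0.
by rewrite mulrN opprK mulfV// f_neq0.
Qed.

Lemma height_gradient u Y : tube c u ->
  ip (grw_metric f c u) (dual_xi c u) Y = 'D_Y (height c) u.
Proof. by move=> /tube_subtube[d [atlas_d du]]; exact: (dual_xi_gradient_sub atlas_d). Qed.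

(** This is the case a = - 1 / f, b = 0 of [dual_curve]. *)
Lemma tangent_dual_xi u : in_chart I c dual u ->
  tangent (in_chart I c dual) u (dual_xi c u).
Proof.
move=> /in_chart_dualP[/tube_subtube[d [atlas_d du]] h0].
have pu := unstraight_in atlas_d du; have uE := unstraightK atlas_d du.
have [Iu _] := du.
rewrite -uE in h0.
have := dual_curve atlas_d (- (f (hd u))^-1) 0 pu h0.
have hE : hd (unstraight d u) = hd u by rewrite /unstraight hd_cons.
have E := dual_xi_straight atlas_d pu hE.
have aE : - (- (f (hd u))^-1 / f (hd (unstraight d u))) = (f (hd u))^-1 ^+ 2.
  by rewrite hE mulNr opprK expr2.
by rewrite aE -E uE.
Qed.

Lemma null_section_dual : null_section (grw_metric f c) (@grw_zeta R m f)
  (in_chart I c dual) (dual_xi c).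
Proof.
split.
  exists (tube c); split; [exact: tube_open| |exact: smooth_dual_xi].
  by move=> u /in_chart_dualP[].
move=> u Lu; have [tu _] := (in_chart_dualP u).1 Lu.
have tg := tangent_dual_xi Lu.
split=> //; last exact: zeta_dual_xi.
by apply: (eq_trans (height_gradient _ tu)); exact: tangent_height.
Qed.

(** The null direction is the gradient of [height], orthogonal to all vectors on
    which the differential of [height] vanishes. *)
Lemma null_hypersurface_in_dual :
  null_hypersurface_in (grw_metric f c) (in_chart I c dual).
Proof.
split=> u Lu; have [tu _] := (in_chart_dualP u).1 Lu.
  exists (tube c), (height c); split=> //.
  - exact: tube_open.
  - exact: smooth_height.
  - by move=> y ty; split=> [/in_chart_dualP[]//|hy]; exact/in_chart_dualP.
  move=> y ty; exists (grw_zeta f y); rewrite -height_gradient//.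
  by rewrite ip_sym ?zeta_dual_xi ?oner_eq0//; case: ty => _ [cy _]; exact: grw_sym.
exists (dual_xi c u).
  split; first exact: tangent_dual_xi.
  apply/eqP => E; have := zeta_dual_xi tu.
  by rewrite E ip0r => /eqP; rewrite eq_sym oner_eq0.
by move=> w tw; apply: (eq_trans (height_gradient _ tu)); exact: tangent_height.
Qed.

Lemma ip_zeta u X : ip (grw_metric f c u) (grw_zeta f u) X = - (f (hd u) * hd X).
Proof. by rewrite ip_grw /grw_zeta !hd_cons !tl_cons ip0l mulr0 addr0. Qed.

(** The screen consists of the vectors tangent to S: orthogonality to zeta kills
    the t-component, and then tangency kills the s-component. *)
Lemma screen_dual (d : chart R (tdS D) m) u X : atlas d -> subtube d u ->
  in_chart I c dual u ->
  screen (grw_metric f c) (@grw_zeta R m f) (in_chart I c dual) u X <->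
  exists v, X = 'D_(cons_rv 0 (cons_rv 0 v)) (straight d) (unstraight d u).
Proof.
move=> atlas_d du Lu; have [tu h0] := (in_chart_dualP u).1 Lu.
have [Iu thu] := du.
have pu := unstraight_in atlas_d du; have uE := unstraightK atlas_d du.
split.
  move=> [/tangent_height tX]; rewrite ip_zeta => /eqP.
  rewrite oppr_eq0 mulf_eq0 (negbTE (f_neq0 Iu)) /= => /eqP X0.
  have := derive_height atlas_d X du; rewrite X0 mul0r addr0 => E.
  have E0 := eq_trans (esym E) tX.
  exists (tl ('D_(tl X) (theta_loc c d) (tl u))).
  apply: (eq_trans (esym (derive_straight_unstraight atlas_d X du))).
  apply: (congr1 (fun b => 'D_b (straight d) (unstraight d u))).
  rewrite X0; apply: (congr1 (fun b => cons_rv 0 b)).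
  apply: (eq_trans (esym (cons_hd_tl _))).
  exact: (congr1 (fun b => cons_rv b _) E0).
case=> v ->; split.
  have h0' : height c (straight d (unstraight d u)) = 0 by rewrite uE.
  by have := dual_curve atlas_d 0 v pu h0'; rewrite mul0r oppr0 uE.
rewrite ip_zeta; apply/eqP; rewrite oppr_eq0 mulf_eq0; apply/orP; right.
apply/eqP.
apply: (eq_trans (congr1 (@hd R _) (derive_straight atlas_d _ pu))).
by rewrite !hd_cons.
Qed.

Lemma umbilic_screen u X Y : in_chart I c dual u ->
  screen (grw_metric f c) (@grw_zeta R m f) (in_chart I c dual) u X ->
  screen (grw_metric f c) (@grw_zeta R m f) (in_chart I c dual) u Y ->
  null_fundamental_form (grw_metric f c) (dual_xi c) u X Y =
  dual_rho (grw_point c u) * ip (grw_metric f c u) X Y.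
Proof.
move=> Lu; have [/tube_subtube[d [atlas_d du]] _] := (in_chart_dualP u).1 Lu.
move=> /(screen_dual _ atlas_d du Lu)[v ->] /(screen_dual _ atlas_d du Lu)[w ->].
have := dual_fundamental_form atlas_d v w (unstraight_in atlas_d du).
by rewrite (unstraightK atlas_d du).
Qed.

Lemma umbilic_dual : umbilic_in (grw_metric f c) (@grw_zeta R m f)
  (in_chart I c dual) (fun u => dual_rho (grw_point c u)).
Proof.
split.
  exists (tube c); split; [exact: tube_open| |exact: smooth_dual_rho].
  by move=> u /in_chart_dualP[].
exists (dual_xi c); first exact: null_section_dual.
exact: umbilic_screen.
Qed.

Lemma mean_curvature_dual u : in_chart I c dual u ->
  null_mean_curvature_in (grw_metric f c) (@grw_zeta R m f) (in_chart I c dual) u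
    (m%:R * dual_rho (grw_point c u)).
Proof.
move=> Lu; have [/tube_subtube[d [atlas_d du]] _] := (in_chart_dualP u).1 Lu.
have pu := unstraight_in atlas_d du; have uE := unstraightK atlas_d du.
set p := unstraight d u in pu uE.
have [Ip [Jp dp _]] := pu.
(* [A] is the metric induced on S, in the chart [d]; an orthonormal basis for it
   maps to one of the screen. *)
pose A := (f (hd p) ^+ 2 * tdmu D (hd (tl p)) (cinv d (tl (tl p))) ^+ 2) *: gram d (tl (tl p)).
have sA : A^T = A by rewrite /A linearZ /= gram_sym.
have pA v : v != 0 -> 0 < ip A v v.
  move=> v0; rewrite /A ipZm mulr_gt0 ?gram_pos// mulr_gt0// exprn_gt0//.
    exact: f_gt0.
  exact: tdmu_gt0.
have [P PE] := posdef_orthonormal sA pA.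
pose vert v : 'rV[R]_(1 + (1 + m)) := 'D_(cons_rv 0 (cons_rv 0 v)) (straight d) p.
have vert_ip v w : ip (grw_metric f c u) (vert v) (vert w) = ip A v w.
  rewrite -{1}uE; apply: (eq_trans (vertical_metric atlas_d _ _ pu)).
  exact: (esym (ipZm _ _ _ _)).
have scr v : screen (grw_metric f c) (@grw_zeta R m f) (in_chart I c dual) u (vert v).
  by apply/(screen_dual _ atlas_d du Lu); exists v.
have onb i j : ip (grw_metric f c u) (vert (row i P)) (vert (row j P)) = (i == j)%:R.
  by rewrite vert_ip ip_row PE mxE.
exists (dual_xi c), m, (fun i => vert (row i P)); split.
- exact: null_section_dual.
- split=> // X /(screen_dual _ atlas_d du Lu)[v ->].
  have [b ->] := orthonormal_span v PE.
  exists b.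
  have dst := smooth_map_differentiable (smooth_straight atlas_d) pu.
  rewrite -/p.
  have -> : cons_rv 0 (cons_rv 0 (\sum_i b i *: row i P)) =
      \sum_i b i *: cons_rv 0 (cons_rv 0 (row i P)) :> 'rV[R]_(1 + (1 + m)).
    by rewrite !cons0_sumZ.
  apply: (eq_trans (derive_sumdir _ _ _ dst)).
  by apply: eq_bigr => i _; exact: deriveZdir.
transitivity (\sum_(i < m) dual_rho (grw_point c u)).
  by rewrite sumr_const card_ord mulr_natl.
apply: eq_bigr => i _.
by rewrite umbilic_screen// onb eqxx mulr1.
Qed.

End Chart.

Lemma dual_totally_umbilic_null : totally_umbilic_null I f (dual_set I f t0 D).
Proof.
split; first split.
- by move=> q [t [s [z [It _ _ ->]]]].
- by move=> c atlas_c; exact: null_hypersurface_in_dual.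
by exists dual_rho => c atlas_c; exact: umbilic_dual.
Qed.

Lemma dual_origin : dual_set I f t0 D (t0, x0).
Proof.
exists t0, 0, (tdz0 D); split=> //; first exact: tdJ0.
  by rewrite oriented_integral_refl.
by rewrite td_origin.
Qed.

Lemma conformal_time_gt0 t : I t -> t0 < t -> 0 < conformal_time t.
Proof.
move=> It t0t; have [_ intI _] := I_interval.
have sub r : t0 <= r <= t -> I r by exact: intI.
have dP r : r \in `]t0, t[%R -> is_derive r 1 conformal_time (f r)^-1.
  rewrite in_itv /= => /andP[/ltW a /ltW b].
  by apply: is_derive_conformal_time; apply: sub; rewrite a.
have cP : {within `[t0, t], continuous conformal_time}.
  apply: derivable_within_continuous => r; rewrite in_itv /= => hr.
  by case: (is_derive_conformal_time (sub _ hr)).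
have [r + E] := MVT t0t dP cP; rewrite in_itv /= => /andP[/ltW a /ltW b].
have P0 : conformal_time t0 = 0 by exact: oriented_integral_refl.
rewrite P0 subr0 in E; rewrite E mulr_gt0 ?subr_gt0// invr_gt0.
by apply: f_gt0; apply: sub; rewrite a.
Qed.

(** Near (t0, x0) the given hypersurface contains (t, Psi (P(t), z0)).  If this
    point were in the dual, P(t) = - P(t), whereas P(t) > 0 for t > t0. *)
Lemma dual_neq (L : set (R * F)) : induced_by I f t0 L D -> dual_set I f t0 D <> L.
Proof.
move=> ind dL.
have P0 : conformal_time t0 = 0 by exact: oriented_integral_refl.
have cP : {for t0, continuous conformal_time}.
  exact/differentiable_continuous/(smooth_differentiable smooth_conformal_time).
pose g t : R * F := (t, tdPsi D (conformal_time t, tdz0 D)).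
have cg : {for t0, continuous g}.
  apply: continuous_pair; first exact: cvg_id.
  apply: (@continuous_comp _ _ _ (fun t => (conformal_time t, tdz0 D)) (tdPsi D)).
    by apply: continuous_pair; [exact: cP|exact: cvg_cst].
  by apply: tdPsi_cont; rewrite /= P0; exact: tdJ0.
have g0 : g t0 = (t0, x0) by rewrite /g P0 td_origin.
have ng : \forall t \near t0, L (g t) <-> primal_set I f t0 D (g t).
  have ind' : nbhs (g t0) [set q | L q <-> primal_set I f t0 D q] by rewrite g0; exact: ind.
  exact: (cg _ ind').
have [oJ _ _] := tdJ_interval D.
have nJ : \forall t \near t0, tdJ D (conformal_time t).
  have J0 : tdJ D (conformal_time t0) by rewrite P0; exact: tdJ0.
  exact: (cP _ (near_open oJ J0)).
have /nbhs_ballP[e /= e0 he] : nbhs t0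
    ([set t | L (g t) <-> primal_set I f t0 D (g t)] `&`
     ([set t | tdJ D (conformal_time t)] `&` I)).
  apply: filterI; first exact: ng.
  by apply: filterI; [exact: nJ|exact: (near_open open_I It0)].
have e20 : 0 < e / 2 by rewrite divr_gt0.
have /he[/= Lg [Jt It]] : ball t0 e (t0 + e / 2).
  rewrite -ball_normE /= opprD addrA subrr add0r normrN gtr0_norm//.
  by rewrite ltr_pdivrMr// ltr_pMr// ltr1n.
set t := t0 + e / 2 in Lg Jt It.
have /Lg : primal_set I f t0 D (g t).
  by exists t, (conformal_time t), (tdz0 D).
rewrite -dL => -[t' [s [z [_ Js sE [tE zE]]]]].
have := congr1 (tdTheta D) zE; rewrite !tdPsiK// => -[E _].
have Pt : 0 < conformal_time t by apply: conformal_time_gt0 => //; rewrite ltrDl.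
have : conformal_time t = - conformal_time t.
  by rewrite {1}E sE -tE oriented_integralN.
by move/eqP; rewrite -addr_eq0 => /eqP E2; have := addr_gt0 Pt Pt; rewrite E2 ltxx.
Qed.

Lemma dual_mean_curvature t s (z : tdS D) : I t -> tdJ D s ->
  s = oriented_integral (fun r => (f r)^-1) t t0 ->
  null_mean_curvature I f (dual_set I f t0 D) (t, tdPsi D (s, z))
    (m%:R / f t ^+ 2 *
       (derive1 f t - derive1 (fun r => tdmu D r z) s / tdmu D s z)).
Proof.
move=> It Js sE c atlas_c /= cq.
set u := cons_rv t _.
have pE : grw_point c u = (t, tdPsi D (s, z)).
  by rewrite /grw_point /u hd_cons tl_cons (cmapK (atlas_chart atlas_c)).
have Lu : in_chart I c (dual_set I f t0 D) u.
  split; rewrite ?pE; first by rewrite /u hd_cons.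
    by rewrite /u tl_cons; exact: cmap_cod.
  by exists t, s, z.
have := mean_curvature_dual atlas_c Lu; rewrite pE /dual_rho /= tdPsiK//=.
by rewrite mulrA mulrAC.
Qed.

End Dual.

Theorem corollary4p5 (R : realType) (m : nat) (I : set R) (f : R -> R)
    (F : riemannian R (1 + m)) (L : set (R * F))
    (I_interval : open_interval I)
    (f_smooth : smooth_on I f)
    (f_gt0 : forall t, I t -> 0 < f t)
    (L_umbilic : totally_umbilic_null I f L)
    (t0 : R) (x0 : F) (L0 : L (t0, x0)) :
  ((exists D : twisted_decomposition x0, induced_by I f t0 L D) ->
    exists Lt : set (R * F),
      [/\ is_dual I f t0 x0 L Lt, totally_umbilic_null I f Lt,
          Lt (t0, x0) & Lt <> L]) /\
  (forall D : twisted_decomposition x0, induced_by I f t0 L D ->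
    [/\ totally_umbilic_null I f (dual_set I f t0 D),
        dual_set I f t0 D (t0, x0), dual_set I f t0 D <> L &
        forall (t s : R) (z : tdS D), I t -> tdJ D s ->
          s = oriented_integral (fun r => (f r)^-1) t t0 ->
          null_mean_curvature I f (dual_set I f t0 D) (t, tdPsi D (s, z))
            (m%:R / f t ^+ 2 *
             (derive1 f t - derive1 (fun r => tdmu D r z) s / tdmu D s z))]).
Proof.
have It0 : I t0 by case: L_umbilic => -[/(_ _ L0)].
have dual_spec (D : twisted_decomposition x0) : induced_by I f t0 L D ->
    [/\ totally_umbilic_null I f (dual_set I f t0 D),
        dual_set I f t0 D (t0, x0) & dual_set I f t0 D <> L].
  move=> ind; split; [exact: dual_totally_umbilic_null|exact: dual_origin|].
  exact: dual_neq ind.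
split=> [[D ind]|D ind]; have [umb org neq] := dual_spec D ind.
  by exists (dual_set I f t0 D); split=> //; exists D.
by split=> // t s z; exact: dual_mean_curvature.
Qed.
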